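(* Let $n$ be a positive integer and $q$ a prime power. The coherent configuration $\mathcal C_3$ on the set $X$ of all subspaces of $\mathbb F_q^n$ is $P$-polynomial.
   Context: **Coherent configurations.** A coherent configuration is a pair $\mathcal C=(X,\mathcal R)$, where $X$ is a nonempty finite set and $\mathcal R=\{R_i\mid i\in I\}$ is a partition of $X\times X$ into nonempty sets such that: if $R_i$ meets $\operatorname{diag}(X\times X)=\{(x,x)\mid x\in X\}$ then $R_i\subseteq\operatorname{diag}(X\times X)$; the transpose of each $R_i$ is in $\mathcal R$; and for all $i,j,h\in I$ the number $|\{z\in X\mid (x,z)\in R_i,(z,y)\in R_j\}|$ does not depend on the choice of $(x,y)\in R_h$. The fibers $X_i$ ($i\in\Omega$) are the classes of the partition of $X$ determined by the relations contained in the diagonal; each relation is contained in a single $X_i\times X_j$. Put $\varepsilon_{i,j}=1-\delta_{i,j}$. The relations in $X_i\times X_j$ are numbered $R^{(i,j)}_\ell$, $\varepsilon_{i,j}\le\ell\le r_{i,j}$, with $R_0^{(i,i)}=\operatorname{diag}(X_i\times X_i)$ and with $R^{(j,i)}_\ell$ the transpose of $R^{(i,j)}_\ell$; put $\widetilde r_{i,j}=r_{i,j}-\varepsilon_{i,j}$. Let $A^{(i,j)}_\ell$ be the adjacency matrix of $R^{(i,j)}_\ell$ (indexed by $X\times X$, or equivalently, as a block, by $X_i\times X_j$), and $\mathcal A^{(i,j)}=\operatorname{span}_{\mathbb C}\{A_\ell^{(i,j)}\}$. **Eigenvalues.** One considers coherent configurations whose fibers carry symmetric association schemes and for which there are matrices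 $E_h^{(i,j)}$ ($i,j\in\Omega$, $0\le h\le\widetilde r_{i,j}$) such that: (B1) $E_0^{(i,j)}=\frac1{\sqrt{|X_i||X_j|}}J$ on the block $X_i\times X_j$ ($J$ all-ones); (B2) $\{E_h^{(i,j)}\}_{h}$ is a basis of $\mathcal A^{(i,j)}$; (B3) the transpose of $E_\ell^{(i,j)}$ is $E_\ell^{(j,i)}$; (B4) $E_\ell^{(i,j)}E_{\ell'}^{(i',j')}=\delta_{j,i'}\delta_{\ell,\ell'}E_\ell^{(i,j')}$. The eigenvalues $P_\ell^{(i,j)}(h)$ are defined by $A_\ell^{(i,j)}=\sum_{h=0}^{\widetilde r_{i,j}}P_\ell^{(i,j)}(h)E_h^{(i,j)}$. **$P$-polynomial.** Such a configuration is $P$-polynomial if for every $i,j\in\Omega$ there is an ordering $A^{(i,j)}_{\varepsilon_{i,j}},\dots,A^{(i,j)}_{r_{i,j}}$ of the adjacency matrices of the block (with $A_0^{(i,i)}$ the identity of $X_i$) such that $P^{(i,j)}_{\varepsilon_{i,j}}(h)\ne0$ for all $0\le h\le\widetilde r_{i,j}$ and, with $\overline{P_\ell^{(i,j)}}(h)=P_\ell^{(i,j)}(h)/P_{\varepsilon_{i,j}}^{(i,j)}(h)$, there are polynomials $v^{(i,j)}_\ell$ ($\varepsilon_{i,j}\le\ell\le r_{i,j}$) with $\deg v_\ell^{(i,j)}=\ell-\varepsilon_{i,j}$ and $\overline{P_\ell^{(i,j)}}(h)=v_\ell^{(i,j)}\bigl(\overline{P_{1+\varepsilon_{i,j}}^{(i,j)}}(h)\bigr)$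 for all $0\le h\le\widetilde r_{i,j}$. (If $\widetilde r_{i,j}=0$ the polynomial condition is trivial.) **The configuration $\mathcal C_3$.** For $0\le i\le n$ let $X_i$ be the set of $i$-dimensional subspaces of $\mathbb F_q^n$. For $0\le i\le j\le n$ and $\varepsilon_{i,j}\le\ell\le\min\{i,n-j\}+\varepsilon_{i,j}$ let $$R_\ell^{(i,j)}=\{(x,y)\in X_i\times X_j\mid \ell=i+\varepsilon_{i,j}-\dim(x\cap y)\},$$ and for $i>j$ let $R_\ell^{(i,j)}$ be the transpose of $R_\ell^{(j,i)}$. Then $\mathcal C_3=(X,\{R_\ell^{(i,j)}\})$, with fibers $X_0,\dots,X_n$; it is a coherent configuration whose fibers carry symmetric association schemes and which admits matrices $E_h^{(i,j)}$ ($0\le i,j\le n$, $0\le h\le\widetilde r_{i,j}$) such that $E_0^{(i,j)}=\frac1{\sqrt{|X_i||X_j|}}J$ on the block $X_i\times X_j$, $\{E_h^{(i,j)}\}_h$ is a basis of $\mathcal A^{(i,j)}$, the transpose of $E_\ell^{(i,j)}$ is $E_\ell^{(j,i)}$, and $E_\ell^{(i,j)}E_{\ell'}^{(i',j')}=\delta_{j,i'}\delta_{\ell,\ell'}E_\ell^{(i,j')}$. *)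

(* Defs.v *)
From HB Require Import structures.
From mathcomp Require Import all_boot all_order all_algebra.
From mathcomp Require Import reals complex.

Set Implicit Arguments.
Unset Strict Implicit.
Unset Printing Implicit Defensive.

Import GRing.Theory Num.Theory.
Local Open Scope ring_scope.

Section CoherentConfiguration.
Variable X : finType.
Implicit Types R S T : {set X * X}.

Definition diag_rel (A : {set X}) : {set X * X} :=
  [set p | (p.1 == p.2) && (p.1 \in A)].

Definition transpose_rel R : {set X * X} := [set p | (p.2, p.1) \in R].

Definition intersection_number R S (p : X * X) : nat :=
  #|[set z | ((p.1, z) \in R) && ((z, p.2) \in S)]|.

(* [partition] already requires the relations to be nonempty. *)
Definition coherent_configuration (Rs : {set {set X * X}}) : Prop :=
  [/\ (0 < #|X|)%N,
      partition Rs [set: X * X],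
      forall R, R \in Rs ->
        R :&: diag_rel [set: X] != set0 -> R \subset diag_rel [set: X],
      forall R, R \in Rs -> transpose_rel R \in Rs
    & forall R S T, R \in Rs -> S \in Rs -> T \in Rs ->
        forall p p', p \in T -> p' \in T ->
          intersection_number R S p = intersection_number R S p'].

End CoherentConfiguration.

(* Only the values [cc_rel i j l] with [eps i j <= l <= cc_max i j] are
   relations of the configuration; the other values are junk. *)
Record configuration (X Omega : finType) := Configuration {
  cc_fiber : Omega -> {set X};
  cc_max : Omega -> Omega -> nat;
  cc_rel : Omega -> Omega -> nat -> {set X * X} }.

Definition eps (Omega : eqType) (i j : Omega) : nat := (i != j).

Section Configuration.
Variables (X Omega : finType) (C : configuration X Omega).
Implicit Types i j : Omega.

Definition in_range i j (l : nat) : bool := (eps i j <= l <= cc_max C i j)%N.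

Definition cc_relations : {set {set X * X}} :=
  [set S | [exists i, exists j, exists l : 'I_(cc_max C i j).+1,
              in_range i j l && (S == cc_rel C i j l)]].

(* The transposition axiom at [i = j] makes every relation inside a fiber
   symmetric: the fibers carry symmetric association schemes.  Together with
   [coherent_configuration], the clauses on [cc_fiber] and the injectivity of
   the numbering make the fibers a partition of X into the classes given by
   the diagonal relations. *)
Definition numbered_coherent_configuration : Prop :=
  [/\ coherent_configuration cc_relations,
      forall i j, (eps i j <= cc_max C i j)%N
        /\ forall l, in_range i j l ->
             cc_rel C i j l \subset setX (cc_fiber C i) (cc_fiber C j),
      forall i, cc_rel C i i 0%N = diag_rel (cc_fiber C i),
      forall i j l, in_range i j l ->
        cc_rel C j i l = transpose_rel (cc_rel C i j l)
    & forall i j l i' j' l', in_range i j l -> in_range i' j' l' ->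
        cc_rel C i j l = cc_rel C i' j' l' -> [/\ i = i', j = j' & l = l']].

Definition rtilde i j : nat := (cc_max C i j - eps i j)%N.

Section Eigenvalues.
Variable K : numClosedFieldType.

(* Matrices with rows and columns in X are indexed through [enum_val];
   a matrix on the block X_i x X_j is extended by zero. *)
Definition adj i j (l : nat) : 'M[K]_#|X| :=
  \matrix_(a, b) ((enum_val a, enum_val b) \in cc_rel C i j l)%:R.

Definition adj_space i j : {vspace 'M[K]_#|X|} :=
  <<[seq adj i j l | l <- index_iota (eps i j) (cc_max C i j).+1]>>%VS.

Definition block_J i j : 'M[K]_#|X| :=
  \matrix_(a, b) ((enum_val a \in cc_fiber C i)
                    && (enum_val b \in cc_fiber C j))%:R.

Variable E : Omega -> Omega -> nat -> 'M[K]_#|X|.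

Definition E_tuple i j : (rtilde i j).+1.-tuple 'M[K]_#|X| :=
  [tuple E i j h | h < (rtilde i j).+1].

(* The product rule is stated for in-range [l] and [l'] only.  The values
   [E i j l] with [rtilde i j < l] are otherwise unconstrained. *)
Definition eigenbasis : Prop :=
  [/\ forall i j, E i j 0%N =
        (sqrtC (#|cc_fiber C i| * #|cc_fiber C j|)%N%:R)^-1 *: block_J i j,
      forall i j, basis_of (adj_space i j) (E_tuple i j),
      forall i j l, (l <= rtilde i j)%N -> (E i j l)^T = E j i l
    & forall i j l i' j' l', (l <= rtilde i j)%N -> (l' <= rtilde i' j')%N ->
        E i j l *m E i' j' l' = ((j == i') && (l == l'))%:R *: E i j' l].

(* [eigenvalue_P i j l h] is the coordinate P_l^(i,j)(h) of A_l^(i,j) on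
   E_h^(i,j); it is meaningful when [E_tuple i j] is a basis of
   [adj_space i j]. *)
Definition eigenvalue_P i j (l : nat) (h : 'I_(rtilde i j).+1) : K :=
  coord (E_tuple i j) h (adj i j l).

Section Ordering.
(* [s l] is the original number of the l-th relation in the new ordering. *)
Variable s : nat -> nat.

Definition ordering i j : Prop :=
  perm_eq [seq s l | l <- index_iota (eps i j) (cc_max C i j).+1]
          (index_iota (eps i j) (cc_max C i j).+1)
  /\ (i = j -> s 0%N = 0%N).

Definition normalized_P i j (l : nat) (h : 'I_(rtilde i j).+1) : K :=
  eigenvalue_P (s l) h / eigenvalue_P (s (eps i j)) h.

(* When [rtilde i j = 0], the relation number [1 + eps i j] does not exist;
   the value of [normalized_P] there is irrelevant because the only
   polynomial involved is then constant. *)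
Definition P_polynomial_ordering i j : Prop :=
  (forall h : 'I_(rtilde i j).+1, eigenvalue_P (s (eps i j)) h != 0)
  /\ exists v : nat -> {poly K}, forall l, in_range i j l ->
       size (v l) = (l - eps i j).+1%N
       /\ forall h : 'I_(rtilde i j).+1,
            normalized_P l h = (v l).[normalized_P (1 + eps i j)%N h].

End Ordering.

Definition P_polynomial_wrt : Prop :=
  forall i j, exists s : nat -> nat, ordering s i j /\ P_polynomial_ordering s i j.

End Eigenvalues.

(* The matrices E are unique only up to signs and relabelling, so the
   property is required for every admissible choice, and an admissible
   choice is required to exist. *)
Definition P_polynomial (K : numClosedFieldType) : Prop :=
  (exists E : Omega -> Omega -> nat -> 'M[K]_#|X|, eigenbasis E)
  /\ forall E : Omega -> Omega -> nat -> 'M[K]_#|X|,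
       eigenbasis E -> P_polynomial_wrt E.

End Configuration.

HB.instance Definition _ (F : finFieldType) (n : nat) :
    isCountable {vspace 'rV[F]_n} :=
  CanIsCountable (@VectorInternalTheory.vs2mxK F 'rV[F]_n).
HB.instance Definition _ (F : finFieldType) (n : nat) :
    isFinite {vspace 'rV[F]_n} :=
  CanIsFinite (@VectorInternalTheory.vs2mxK F 'rV[F]_n).

Section SubspaceConfiguration.
Variables (F : finFieldType) (n : nat).
Local Notation X := {vspace 'rV[F]_n}.
Implicit Types i j : 'I_n.+1.

Definition subspaces i : {set X} := [set U | \dim U == i].

(* For [i <= j]; the subtraction is never truncated since
   [\dim (U :&: V) <= \dim U = i]. *)
Definition C3_rel_le i j (l : nat) : {set X * X} :=
  [set p in setX (subspaces i) (subspaces j)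
     | l == (i + eps i j - \dim (p.1 :&: p.2))%N].

Definition C3_rel i j (l : nat) : {set X * X} :=
  if (i <= j)%N then C3_rel_le i j l else transpose_rel (C3_rel_le j i l).

Definition C3_max i j : nat :=
  if (i <= j)%N then (minn i (n - j) + eps i j)%N
  else (minn j (n - i) + eps j i)%N.

Definition C3 : configuration X 'I_n.+1 :=
  Configuration subspaces C3_max C3_rel.

End SubspaceConfiguration.

(* Main.v *)
Require Import Defs.
From mathcomp Require Import all_boot all_order all_algebra.
From mathcomp Require Import finfield zify ring.
From mathcomp Require Import reals complex.

(** Why the theorem holds.

    The pairs of subspaces in one relation of C_3 form one orbit of the general
    linear group ([GL_transitive]): the relation records the dimensions of the
    two subspaces and of their meet, and these determine the pair up to a
    change of basis.  Intersection numbers are therefore well defined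
    ([C3_coherent]), and the matrices that are invariant under the group and
    supported on one block are exactly the combinations of the adjacency
    matrices of that block ([mem_adj_space]).

    The matrices E are built from the ladder structure of the subspace lattice.
    Let U and D be the matrices that raise and lower the dimension by one.  Two
    distinct subspaces of the same dimension have a common upper cover exactly
    when they have a common lower cover, and both are then unique, so DU - UD is
    scalar on each level i; the scalar is [n - i]_q - [i]_q ([downup_comm]).
    As for representations of sl_2, a harmonic function (one killed by D) of
    level h generates a string of eigenvectors of DU, with eigenvalues that are
    partial sums of these scalars; the sums vanish first at level n - h
    ([comm_sum_gt0], [down_raise]).  The projector G_h onto the harmonic
    functions of level h is a polynomial in UD, hence invariant, and it is
    nonzero when 2h <= n because level h is then larger than level h - 1
    ([harmonic_neq0]).  The matrices U^(i-h) G_h D^(j-h), suitably scaled, are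
    matrix units ([eigmx_mul]); in block (i, j) there are as many of them as
    relations, so they form a basis.

    The polynomials are found for an arbitrary admissible E.  For i <= j,
    multiplying A_l^(i,j) on the left by the matrix T of the relation 1 on
    level i gives a nonzero multiple of A_(l+1)^(i,j) plus a combination of the
    A_m^(i,j) with m <= l ([adjacent_mul]): moving a subspace to a neighbour
    changes its meet with a fixed subspace by at most one dimension, and the
    meet can be enlarged as long as it is not maximal.  Since each E_h is an
    eigenvector of T, with eigenvalue tau(h) say, P_l(h) is a polynomial of
    degree l - eps in tau(h), times P_eps(h).  So P_eps(h) cannot vanish:
    otherwise all P_l(h) would, and E_h would not be in the span of the A_l.
    Dividing by P_eps(h), the polynomial of degree one turns tau(h) into an
    affine function of the normalized second eigenvalue, which can be
    substituted in the others ([P_polynomial_le]).  Transposition settles the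
    case i > j. *)

Set Implicit Arguments.
Unset Strict Implicit.
Unset Printing Implicit Defensive.

Import Order.TTheory GRing.Theory Num.Theory.
Local Open Scope ring_scope.

(** * Subspaces, frames and the general linear group *)

Section FreeFamilies.
Variables (K : fieldType) (vT : vectType K).
Implicit Types (U V W : {vspace vT}) (b : seq vT).

Lemma free_full_span b : free b -> size b = \dim {:vT} -> <<b>>%VS = fullv.
Proof.
by move=> /eqnP fb sb; apply/eqP; rewrite eqEdim subvf fb sb leqnn.
Qed.

Lemma free_cat_span U V b1 b2 : basis_of U b1 -> basis_of V b2 ->
  (U :&: V = 0)%VS -> basis_of (U + V) (b1 ++ b2).
Proof. by move=> h1 h2 h; apply: cat_basis => //; apply/directv_addP. Qed.

Lemma exists_lfun_of_free b b' : free b -> free b' ->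
  size b = \dim {:vT} -> size b' = \dim {:vT} ->
  exists2 g : 'End(vT), lker g == 0%VS & map g b = b'.
Proof.
move=> fb fb' sb sb'; have [f fP] := linear_of_free b b'.
have {fP} fb'E : map (linfun f) b = b'.
  by rewrite -[RHS]fP ?sb' //; apply: eq_map => v; rewrite lfunE.
exists (linfun f) => //.
have := limg_ker_dim (linfun f) fullv.
rewrite -[X in (linfun f @: X)%VS](free_full_span fb sb) limg_span fb'E.
rewrite (free_full_span fb' sb') capfv => /eqP.
by rewrite -[X in _ == X]add0n eqn_add2r dimv_eq0.
Qed.

(** A basis of the space adapted to two subspaces: [b1] spans the meet, and
    [b4] a complement of the sum. *)
Lemma exists_common_basis U V : exists b1 b2 b3 b4 : seq vT,
  [/\ free (b1 ++ b2 ++ b3 ++ b4),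
      <<b1 ++ b2>>%VS = U, <<b1 ++ b3>>%VS = V &
      [/\ size b1 = \dim (U :&: V), size (b1 ++ b2) = \dim U,
          size (b1 ++ b3) = \dim V &
          size (b1 ++ b2 ++ b3 ++ b4) = \dim {:vT}]].
Proof.
have bas W : basis_of W (vbasis W) by apply: vbasisP.
pose b1 := vbasis (U :&: V); pose b2 := vbasis (U :\: V).
pose b3 := vbasis (V :\: U); pose b4 := vbasis ((U + V)^C).
exists b1, b2, b3, b4.
have hU : basis_of U (b1 ++ b2).
  rewrite -[U in basis_of U](addv_diff_cap U V) addvC; apply: free_cat_span => //.
  by apply/eqP; rewrite -subv0 -(capv_diff U V) capvC capvS // capvSr.
have hV : basis_of V (b1 ++ b3).
  rewrite -[V in basis_of V](addv_diff_cap V U) addvC (capvC V U).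
  apply: free_cat_span => //.
  by apply/eqP; rewrite -subv0 -(capv_diff V U) capvC capvS // capvSl.
have hUV : basis_of (U + V) ((b1 ++ b2) ++ b3).
  rewrite addvC -addv_diff addvC; apply: free_cat_span => //.
  by rewrite capvC capv_diff.
have hall : basis_of {:vT} (((b1 ++ b2) ++ b3) ++ b4).
  rewrite -(addv_complf (U + V)); apply: free_cat_span => //.
  exact: capv_compl.
have sz W b : basis_of W b -> size b = \dim W.
  by move=> h; rewrite -(span_basis h); apply/esym/eqnP/basis_free/h.
rewrite !catA; split; rewrite ?(span_basis hU) ?(span_basis hV) //.
  exact: basis_free hall.
by split; rewrite ?(sz _ _ hU) ?(sz _ _ hV) ?(sz _ _ hall) // (sz _ _ (bas _)).
Qed.

(** Two adapted bases with the same block sizes are exchanged by a linear map,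
    which then carries one pair of subspaces to the other. *)
Lemma GL_transitive U V U' V' :
  \dim U = \dim U' -> \dim V = \dim V' ->
  \dim (U :&: V) = \dim (U' :&: V') ->
  exists g : 'End(vT), [/\ lker g == 0%VS, (g @: U = U')%VS & (g @: V = V')%VS].
Proof.
have [b1 [b2 [b3 [b4 [fb <- <- [s1 s2 s3 s4]]]]]] := exists_common_basis U V.
have [c1 [c2 [c3 [c4 [fc <- <- [t1 t2 t3 t4]]]]]] := exists_common_basis U' V'.
rewrite -s1 -s2 -s3 -t1 -t2 -t3 !size_cat => e2 e3 e1.
have [g kg] := exists_lfun_of_free fb fc s4 t4.
rewrite e1 in e2 e3; move: e2 e3 => /addnI e2 /addnI e3.
rewrite !map_cat => /eqP; rewrite !eqseq_cat ?size_map //.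
case/and4P=> /eqP g1 /eqP g2 /eqP g3 _.
by exists g; split; rewrite // limg_span map_cat ?g1 ?g2 ?g3.
Qed.

Lemma capv_line U x : x \notin U -> (<[x]> :&: U = 0)%VS.
Proof.
move=> xU; apply/eqP; rewrite -subv0; apply/subvP => y.
rewrite memv_cap => /andP[/vlineP[k yk] yU].
have [k0|k0] := eqVneq k 0; first by rewrite yk k0 scale0r mem0v.
by case/negP: xU; rewrite -(scalerK k0 x) -yk memvZ.
Qed.

Lemma dim_addv_line U x : x \notin U -> \dim (U + <[x]>) = (\dim U).+1.
Proof.
move=> xU; rewrite dimv_disjoint_sum; last by rewrite capvC capv_line.
by rewrite dim_vline (contraNneq _ xU) ?addn1 // => ->; rewrite mem0v.
Qed.

(** The spans of two subfamilies of a basis that share [m] vectors. *)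
Lemma exists_pair_dim i j m : (m <= minn i j)%N -> (i + j - m <= \dim {:vT})%N ->
  exists U V, [/\ \dim U = i, \dim V = j & \dim (U :&: V) = m].
Proof.
rewrite leq_min => /andP[mi mj] le.
have [b fb sb] : exists2 b : seq vT, free b & size b = \dim {:vT}.
  by exists (vbasis {:vT}); rewrite ?size_tuple // (basis_free (vbasisP _)).
pose b1 := take m b; pose b2 := take (i - m) (drop m b).
pose b3 := take (j - m) (drop (i - m) (drop m b)).
have s1 : size b1 = m by rewrite size_takel // sb; lia.
have s2 : size b2 = (i - m)%N by rewrite size_takel // size_drop sb; lia.
have s3 : size b3 = (j - m)%N by rewrite size_takel // !size_drop sb; lia.
have f123 : free (b1 ++ b2 ++ b3).
  have : free (b1 ++ b2 ++ b3 ++ drop (j - m) (drop (i - m) (drop m b))).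
    by rewrite !cat_take_drop.
  by rewrite !catA => /catl_free.
have f12 : free (b1 ++ b2) by move: f123; rewrite catA => /catl_free.
have f13 : free (b1 ++ b3).
  have : free (b2 ++ b1 ++ b3) by rewrite (@perm_free _ _ _ (b1 ++ b2 ++ b3)) // perm_catCA.
  by move/catr_free.
have d12 : \dim <<b1 ++ b2>> = i by rewrite (eqnP f12) size_cat s1 s2; lia.
have d13 : \dim <<b1 ++ b3>> = j by rewrite (eqnP f13) size_cat s1 s3; lia.
exists <<b1 ++ b2>>%VS, <<b1 ++ b3>>%VS; split=> //.
have := dimv_sum_cap <<b1 ++ b2>> <<b1 ++ b3>>.
have -> : (<<b1 ++ b2>> + <<b1 ++ b3>> = <<b1 ++ b2 ++ b3>>)%VS.
  rewrite !span_cat; rewrite addvA -(addvA <<b1>>%VS) (addvC <<b2>>%VS) addvA addvv.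
  by rewrite addvA.
rewrite (eqnP f123) !size_cat s1 s2 s3 d12 d13; lia.
Qed.

End FreeFamilies.

Section Neighbours.
Variables (K : fieldType) (vT : vectType K).
Implicit Types (U V W : {vspace vT}).

(** Inside [W], the subspaces [W :&: V] and [U :&: W] meet in a subspace of
    [U :&: V].  When [U] is adjacent to [W], this says that passing from [W] to
    [U] lowers the dimension of the meet with [V] by at most one. *)
Lemma dim_cap_adjacent U V W :
  (\dim (W :&: V) + \dim (U :&: W) <= \dim (U :&: V) + \dim W)%N.
Proof.
rewrite -dimv_sum_cap addnC; apply: leq_add; apply: dimvS.
  by apply/subvP => v; rewrite !memv_cap => /andP[/andP[_ ->] /andP[-> _]].
by rewrite subv_add capvSl capvSr.
Qed.

(** Exchange step: replace a vector [v] of [U] outside [V] by a vector [w] of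
    [V] outside [U], keeping a hyperplane [H] of [U] that contains the meet. *)
Lemma exists_closer U V : (\dim (U :&: V) < \dim U <= \dim V)%N ->
  exists W, [/\ \dim W = \dim U, (\dim (U :&: W)).+1 = \dim U
              & \dim (W :&: V) = (\dim (U :&: V)).+1].
Proof.
move=> /andP[dU dV].
have /subvPn[w wV wU] : ~~ (V <= U)%VS.
  by apply: contraL dU => /capv_idPr->; rewrite -leqNgt.
have /subvPn[v vU vV] : ~~ (U <= U :&: V)%VS.
  by apply: contraL dU => /dimvS; rewrite -leqNgt.
pose S := (U :&: V + <[v]>)%VS; pose D := (U :\: S)%VS; pose H := (U :&: V + D)%VS.
have cw := capv_line wU.
have dS : \dim S = (\dim (U :&: V)).+1 by apply: dim_addv_line.
have SU : (S <= U)%VS by rewrite subv_add capvSl -memvE.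
have dD : (\dim S + \dim D = \dim U)%N.
  by rewrite -(dimv_cap_compl U S); move/capv_idPr: SU => ->.
have HU : (H <= U)%VS by rewrite subv_add capvSl diffvSl.
have dH : (\dim H).+1 = \dim U.
  rewrite dimv_disjoint_sum; first by rewrite -dD dS.
  apply/eqP; rewrite -subv0 -(capv_diff U S) capvC capvS //.
  by rewrite addvSl.
have UW : (U :&: (H + <[w]>) = H)%VS.
  by rewrite capvC -vspace_modl // cw addv0.
have dW : \dim (H + <[w]>) = \dim U.
  by rewrite dim_addv_line // (contra _ wU) // => /(subvP HU).
exists (H + <[w]>)%VS; rewrite UW; split=> //.
apply/eqP; rewrite eqn_leq; apply/andP; split.
  by have := dim_cap_adjacent U V (H + <[w]>); rewrite UW dW -dH; lia.
have <- : \dim (U :&: V + <[w]>) = (\dim (U :&: V)).+1.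
  by rewrite dim_addv_line // (contra _ wU) // => /(subvP (capvSl _ _)).
apply: dimvS; rewrite subv_cap addvS ?addvSl //=.
by rewrite subv_add capvSr -memvE.
Qed.

End Neighbours.

(** * Orthogonal subspaces and covering degrees *)

Section Orthogonal.
Variables (F : fieldType) (n : nat).
Local Notation X := {vspace 'rV[F]_n}.
Implicit Types U V : X.

Lemma dim_rV m : \dim {:'rV[F]_m} = m.
Proof. by rewrite dimvf /dim /= mul1n. Qed.

Definition basis_mx U : 'M[F]_(\dim U, n) := \matrix_(k < \dim U) (vbasis U)`_k.

(** The orthogonal of [U] for the standard bilinear form. *)
Definition perp U : X :=
  lker (linfun (mulmxr (basis_mx U)^T : 'rV[F]_n -> 'rV[F]_(\dim U))).

Lemma memv_perp U v : reflect (forall u, u \in U -> v *m u^T = 0) (v \in perp U).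
Proof.
rewrite memv_ker lfunE /=; apply: (iffP eqP) => [h u uU|h].
  rewrite (coord_vbasis uU) linear_sum mulmx_sumr big1 // => i _.
  rewrite linearZ -scalemxAr; apply/eqP; rewrite scaler_eq0; apply/orP; right.
  move/rowP: h => /(_ i); rewrite !mxE => h; apply/eqP/rowP => j; rewrite !mxE -[RHS]h.
  by apply: eq_bigr => k _; rewrite /= !mxE ord1.
apply/rowP => i; have := h _ (vbasis_mem (mem_nth 0 (_ : i < size (vbasis U))%N)).
rewrite size_tuple ltn_ord => /(_ isT) /rowP /(_ 0); rewrite !mxE => {}h.
by rewrite -[RHS]h; apply: eq_bigr => k _; rewrite !mxE.
Qed.

Lemma row_free_basis_mx U : row_free (basis_mx U).
Proof.
apply: inj_row_free => v v0; apply/rowP => i; rewrite mxE.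
have fU : free (vbasis U) := basis_free (vbasisP U).
rewrite -(coord_sum_free (fun i => v 0 i) i fU) -[RHS](linear0 (coord (vbasis U) i)).
congr (coord _ _ _); transitivity (v *m basis_mx U) => //.
apply/rowP => k; rewrite summxE mxE; by apply: eq_bigr => j _; rewrite !mxE.
Qed.

Lemma dim_perp U : \dim (perp U) = (n - \dim U)%N.
Proof.
set f := linfun (mulmxr (basis_mx U)^T : 'rV[F]_n -> 'rV[F]_(\dim U)).
have := limg_ker_dim f fullv; rewrite capfv.
have /row_freeP[B AB] := row_free_basis_mx U.
have -> : limg f = fullv.
  apply/eqP; rewrite eqEsubv subvf; apply/subvP => w _.
  apply/memv_imgP; exists (w *m B^T); first exact: memvf.
  by rewrite lfunE /= -mulmxA -trmx_mul AB trmx1 mulmx1.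
rewrite !dim_rV => e; apply/eqP; rewrite -(eqn_add2r (\dim U)) e.
by have := dimvS (subvf U); rewrite dim_rV => /subnK ->.
Qed.

Lemma perpS U V : (U <= V)%VS -> (perp V <= perp U)%VS.
Proof.
move=> /subvP UV; apply/subvP => v /memv_perp h.
by apply/memv_perp => u /UV /h.
Qed.

Lemma perpK : involutive perp.
Proof.
move=> U; apply/esym/eqP; rewrite eqEdim !dim_perp.
have := dimvS (subvf U); rewrite dim_rV => le.
rewrite subKn // leqnn andbT; apply/subvP => u uU; apply/memv_perp => v.
by move=> /memv_perp/(_ u uU) h; rewrite -[LHS]trmxK trmx_mul trmxK h trmx0.
Qed.

Lemma perp_le U V : (perp U <= perp V)%VS = (V <= U)%VS.
Proof. by apply/idP/idP => /perpS //; rewrite !perpK. Qed.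

End Orthogonal.

Section Degrees.
Variables (F : finFieldType) (n : nat).
Local Notation X := {vspace 'rV[F]_n}.
Local Notation q := #|F|.
Implicit Types U V W : X.

Lemma dim_le U : (\dim U <= n)%N.
Proof. by have := dimvS (subvf U); rewrite dim_rV. Qed.

Definition covers U V : bool := (U <= V)%VS && (\dim V == (\dim U).+1).

Lemma covers_addv U v : v \notin U -> covers U (U + <[v]>)%VS.
Proof.
by move=> vU; rewrite /covers addvSl dim_addv_line ?eqxx.
Qed.

Lemma coversE U V v : v \notin U -> v \in V -> covers U V -> V = (U + <[v]>)%VS.
Proof.
move=> vU vV /andP[UV /eqP dV]; apply/esym/eqP; rewrite eqEdim subv_add UV -memvE vV dV.
by have /andP[_ /eqP->] := covers_addv vU; rewrite leqnn.
Qed.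

Definition qint (m : nat) : nat := (\sum_(k < m) q ^ k)%N.

Lemma qintM m : (qint m * (q - 1) = q ^ m - 1)%N.
Proof.
elim: m => [|m IH]; first by rewrite /qint big_ord0.
rewrite /qint big_ord_recr /= mulnDl -/(qint m) IH expnSr mulnBr muln1.
have : (0 < q ^ m)%N by rewrite expn_gt0 (ltnW (finNzRing_gt1 F)).
have := leq_pmulr (q ^ m) (ltnW (finNzRing_gt1 F)).
by move: (q ^ m)%N (q ^ m * q)%N => a b; lia.
Qed.

Lemma ltn_qint : {mono qint : a b / (a < b)%N}.
Proof.
apply: leqW_mono; apply: leq_mono => a b ab; rewrite /qint -(subnKC ab).
rewrite big_split_ord /= big_ord_recr /= -addnA -[X in (X < _)%N]addn0 ltn_add2l.
rewrite (leq_trans _ (leq_addr _ _)) // expn_gt0.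
by rewrite (ltnW (finNzRing_gt1 F)).
Qed.

Lemma sum_mem_diff U W : (U <= W)%VS ->
  (\sum_(v | v \notin U) (v \in W) + q ^ \dim U = q ^ \dim W)%N.
Proof.
move=> /subvP UW; rewrite -!card_vspace -!sum1_card [in RHS]big_mkcond /=.
rewrite [RHS](bigID (fun v => v \in U)) /= [RHS]addnC; congr addn.
by apply: eq_bigr => v /UW ->.
Qed.

(** Every vector outside [U] lies in exactly one cover of [U], and each cover
    contains the same number of such vectors. *)
Lemma card_upper_covers U : #|[set V | covers U V]| = qint (n - \dim U).
Proof.
have q1 := finNzRing_gt1 F; have dn := dim_le U.
have : (\sum_(V | covers U V) \sum_(v | v \notin U) (v \in V)
        = \sum_(v | v \notin U) \sum_(V | covers U V) (v \in V))%N.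
  exact: exchange_big.
have -> : (\sum_(v | v \notin U) \sum_(V | covers U V) (v \in V)
           = q ^ n - q ^ \dim U)%N.
  have dfull : \dim {:'rV[F]_n} = n by rewrite dim_rV.
  rewrite -[X in (q ^ X - _)%N]dfull -(sum_mem_diff (subvf U)) addnK.
  apply: eq_bigr => v vU; rewrite memvf (bigD1 (U + <[v]>)%VS) ?covers_addv //=.
  rewrite memvE addvSr big1 // => V /andP[UV]; apply: contraNeq.
  by rewrite -lt0n lt0b => vV; rewrite (coversE vU vV UV).
rewrite (eq_bigr (fun=> q ^ (\dim U).+1 - q ^ \dim U)%N); last first.
  by move=> V /andP[UV /eqP <-]; rewrite -(sum_mem_diff UV) addnK.
rewrite sum_nat_const cardsE expnSr -{2}(muln1 (q ^ _)%N) -mulnBr => h.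
have qd : (0 < q ^ \dim U)%N by rewrite expn_gt0 (ltnW q1).
apply/eqP; rewrite -(@eqn_pmul2r (q - 1)) ?subn_gt0 // qintM.
rewrite -(eqn_pmul2l qd) mulnCA h mulnBr muln1 -expnD.
by rewrite subnKC.
Qed.

(** Orthogonality turns the hyperplanes of [V] into the upper covers of its
    orthogonal. *)
Lemma card_lower_covers V : #|[set U | covers U V]| = qint (\dim V).
Proof.
rewrite -[X in qint X](subKn (dim_le V)) -dim_perp -card_upper_covers.
rewrite -(card_imset _ (inv_inj (@perpK F n))); congr #|pred_of_set _|.
apply/setP => W; rewrite inE; apply/imsetP/idP => [[U]|].
  rewrite inE /covers => /andP[UV /eqP dV] ->; rewrite perp_le UV !dim_perp.
  by have := dim_le V; rewrite dV => lt; apply/eqP; rewrite -subSn ?subSS.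
rewrite /covers dim_perp => /andP[VW /eqP dW]; exists (perp W); last by rewrite perpK.
rewrite inE /covers -perp_le perpK VW dim_perp dW.
have := dim_le W; have le := dim_le V; rewrite dW => lt; apply/eqP.
by rewrite -subSn ?subSS ?subKn.
Qed.

(** Together with [covers_meetP]: a common upper cover exists under the same
    condition as a common lower cover, which is what makes the off-diagonal
    entries of the two products of the up and down operators agree. *)
Lemma covers_joinP U V W : U != V -> \dim U = \dim V ->
  (covers U W && covers V W) =
  ((\dim (U :&: V)).+1 == \dim U) && (W == (U + V)%VS).
Proof.
move=> UV dUV; have sumcap := dimv_sum_cap U V.
have ltcap : (\dim U < \dim (U + V))%N.
  rewrite ltn_neqAle dimvS ?addvSl // andbT; apply: contraNneq UV => e.
  rewrite eq_sym eqEdim dUV leqnn andbT; apply/addv_idPl/esym/eqP.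
  by rewrite eqEdim addvSl -e leqnn.
apply/idP/idP => [/andP[/andP[UW dW] /andP[VW _]]|/andP[/eqP dc /eqP->]].
  have UVW : (U + V <= W)%VS by rewrite subv_add UW.
  have := dimvS UVW; rewrite (eqP dW) => le.
  have e : \dim (U + V) = (\dim U).+1 by apply/eqP; rewrite eqn_leq le.
  apply/andP; split; first lia.
  by rewrite eq_sym eqEdim UVW e (eqP dW) leqnn.
rewrite /covers addvSl addvSr /=; lia.
Qed.

Lemma covers_meetP U V W : U != V -> \dim U = \dim V ->
  (covers W U && covers W V) =
  ((\dim (U :&: V)).+1 == \dim U) && (W == (U :&: V)%VS).
Proof.
move=> UV dUV.
have ltcap : (\dim (U :&: V) < \dim U)%N.
  rewrite ltn_neqAle dimvS ?capvSl // andbT; apply: contraNneq UV => e.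
  rewrite eqEdim -dUV leqnn andbT; apply/capv_idPl/eqP.
  by rewrite eqEdim capvSl -e leqnn.
apply/idP/idP => [/andP[/andP[WU /eqP dU] /andP[WV _]]|/andP[/eqP dc /eqP->]].
  have WUV : (W <= U :&: V)%VS by rewrite subv_cap WU.
  have := dimvS WUV => le; have e : \dim W = \dim (U :&: V) by lia.
  by rewrite eqEdim WUV -e leqnn -dU eqxx.
by rewrite /covers capvSl capvSr /= -dUV dc eqxx.
Qed.

End Degrees.

(** * Matrices and polynomials *)

Section Idempotent.

Lemma mxtrace_idempotent (K : fieldType) m (A : 'M[K]_m) :
  A *m A = A -> \tr A = (\rank A)%:R.
Proof.
move=> AA.
have factor r (c : 'M_(m, r)) (b : 'M_(r, m)) :
    c *m b = A -> row_free b -> row_full c -> \tr A = r%:R.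
  move=> cb fb fc; rewrite -cb mxtrace_mulC; suff -> : b *m c = 1%:M by rewrite mxtrace1.
  apply: (row_free_inj fb); apply: (row_full_inj fc).
  by rewrite mul1mx !mulmxA cb -mulmxA cb AA.
exact: (factor _ _ _ (mulmx_base A) (row_base_free A) (col_base_full A)).
Qed.

End Idempotent.

Section Entries.
Variables (R : comNzRingType) (T : finType).
Implicit Types A B : 'M[R]_#|T|.

(** Matrices on a finite type are indexed by ordinals; [ent] reads them as
    kernels on the type itself. *)
Definition ent A (x y : T) : R := A (enum_rank x) (enum_rank y).

Definition mx_of (f : T -> T -> R) : 'M[R]_#|T| :=
  \matrix_(a, b) f (enum_val a) (enum_val b).

Lemma ent_mx_of f x y : ent (mx_of f) x y = f x y.
Proof. by rewrite /ent mxE !enum_rankK. Qed.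

Lemma entP A B : (forall x y, ent A x y = ent B x y) -> A = B.
Proof.
move=> h; apply/matrixP => a b; have := h (enum_val a) (enum_val b).
by rewrite /ent !enum_valK.
Qed.

Lemma entD A B x y : ent (A + B) x y = ent A x y + ent B x y.
Proof. by rewrite /ent mxE. Qed.

Lemma entB A B x y : ent (A - B) x y = ent A x y - ent B x y.
Proof. by rewrite /ent !mxE. Qed.

Lemma entZ c A x y : ent (c *: A) x y = c * ent A x y.
Proof. by rewrite /ent mxE. Qed.

Lemma ent_sum I (r : seq I) (P : pred I) (A : I -> 'M[R]_#|T|) x y :
  ent (\sum_(i <- r | P i) A i) x y = \sum_(i <- r | P i) ent (A i) x y.
Proof. by rewrite /ent summxE. Qed.

Lemma ent_tr A x y : ent A^T x y = ent A y x.
Proof. by rewrite /ent mxE. Qed.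

Lemma ent_mul A B x y : ent (A *m B) x y = \sum_z ent A x z * ent B z y.
Proof.
rewrite /ent mxE (reindex (@enum_rank T)) //=.
by exists enum_val => ? _; rewrite ?enum_rankK ?enum_valK.
Qed.

End Entries.

Section Recursion.
Variable K : fieldType.

(** Solving the recursion for [p k.+1] gives
    [w k.+1 = c^-1 *: (w k * 'X - ...)], whose degree is one more than that of
    [w k] because [c] is invertible. *)
Lemma polynomials_of_recursion (I : Type) (tau : I -> K) (p : nat -> I -> K) r :
  (forall k, (k < r)%N -> exists2 c, c != 0 & exists a : nat -> K,
     forall x, tau x * p k x = c * p k.+1 x + \sum_(m < k.+1) a m * p m x) ->
  exists w : nat -> {poly K}, forall k, (k <= r)%N ->
    size (w k) = k.+1 /\ forall x, p k x = (w k).[tau x] * p 0%N x.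
Proof.
elim: r => [|r IH] hp.
  exists (fun=> 1) => k; rewrite leqn0 => /eqP->.
  by rewrite size_poly1; split=> // x; rewrite hornerE mul1r.
have [k kr|w hw] := IH; first by apply: hp; apply: ltnW.
have [c c0 [a ha]] := hp r (leqnn _).
pose u := c^-1 *: (w r * 'X - \sum_(m < r.+1) a m *: w m).
exists (fun k => if k == r.+1 then u else w k) => k.
rewrite leq_eqVlt ltnS; case: eqP => [-> _|_ /= /hw //].
have [sr er] := hw _ (leqnn r).
have wr0 : w r != 0 by rewrite -size_poly_eq0 sr.
split=> [|x].
  rewrite size_scale ?invr_eq0 // size_polyDl size_mulX ?sr // size_polyN ltnS.
  rewrite (leq_trans (size_sum _ _ _)) //; apply/bigmax_leqP => m _.
  have [sm _] := hw m (leq_ord m).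
  by rewrite (leq_trans (size_scale_leq _ _)) // sm.
rewrite hornerZ hornerD hornerN hornerMX (mulrC _ (tau x)) -mulrA mulrBl -mulrA -er ha.
rewrite horner_sum mulr_suml [X in _ + X - _](eq_bigr
  (fun m : 'I_r.+1 => (a m *: w m).[tau x] * p 0%N x)).
  by rewrite addrK mulKf.
by move=> m _; have [_ em] := hw m (leq_ord m); rewrite em hornerZ mulrA.
Qed.

End Recursion.

(** * The coherent configuration of subspaces *)

Section SubspaceConfigurationTheory.
Variables (F : finFieldType) (n : nat).
Local Notation X := {vspace 'rV[F]_n}.
Local Notation C := (C3 F n).
Implicit Types (U V W : X) (i j : 'I_n.+1).

Lemma eps_sym i j : eps i j = eps j i.
Proof. by rewrite /eps eq_sym. Qed.

(** A description of the relations that does not distinguish [i <= j] from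
    [i > j]; the symmetry under transposition is read off from it. *)
Lemma C3_relE i j l p : (p \in cc_rel C i j l) =
  [&& \dim p.1 == i, \dim p.2 == j & l == (minn i j + eps i j - \dim (p.1 :&: p.2))%N].
Proof.
rewrite /= /C3_rel /C3_rel_le; case: (leqP i j) => ij; rewrite !inE.
  by rewrite andbA.
by rewrite /= capvC eps_sym andbA (andbC (_ == _)%N).
Qed.

Lemma cc_maxE i j : cc_max C i j = (minn (minn i j) (n - maxn i j) + eps i j)%N.
Proof. by rewrite /= /C3_max eps_sym; case: leqP. Qed.

Lemma rtildeE i j : rtilde C i j = minn (minn i j) (n - maxn i j).
Proof. by rewrite /rtilde cc_maxE addnK. Qed.

Lemma rtilde_sym i j : rtilde C i j = rtilde C j i.
Proof. by rewrite !rtildeE minnC [maxn i j]maxnC minnC [minn j i]minnC. Qed.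

Lemma cap_dim_bounds U V : (\dim (U :&: V) <= minn (\dim U) (\dim V))%N /\
  (\dim U + \dim V <= n + \dim (U :&: V))%N.
Proof.
split; first by rewrite leq_min !dimvS ?capvSl ?capvSr.
by rewrite -dimv_sum_cap leq_add2r dim_le.
Qed.

Lemma ord_dim U : exists i : 'I_n.+1, \dim U = i.
Proof. by exists (Ordinal (dim_le U : \dim U < n.+1)%N). Qed.

Lemma C3_rel_exists i j l : in_range C i j l ->
  exists p, p \in cc_rel C i j l.
Proof.
rewrite /in_range cc_maxE => lr; have := ltn_ord i; have := ltn_ord j => lj li.
have [||U [V [dU dV dc]]] := @exists_pair_dim F 'rV[F]_n i j (minn i j + eps i j - l).
- by move: (eps i j) lr => e; lia.
- by rewrite dim_rV; move: (eps i j) lr => e; lia.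
exists (U, V); rewrite C3_relE /= dU dV dc !eqxx /=.
by move: (eps i j) lr => e; lia.
Qed.

Lemma C3_rel_cover p : exists i j l, in_range C i j l /\ p \in cc_rel C i j l.
Proof.
case: p => U V; have [i di] := ord_dim U; have [j dj] := ord_dim V.
exists i, j, (minn i j + eps i j - \dim (U :&: V))%N.
rewrite C3_relE /= di dj !eqxx /in_range cc_maxE; split => //.
have [] := cap_dim_bounds U V; rewrite di dj.
by move: (eps i j) (\dim (U :&: V)) => e d; lia.
Qed.

Lemma C3_rel_inj i j l i' j' l' p : p \in cc_rel C i j l -> p \in cc_rel C i' j' l' ->
  [/\ i = i', j = j' & l = l'].
Proof.
rewrite !C3_relE => /and3P[/eqP e1 /eqP e2 /eqP e3] /and3P[/eqP f1 /eqP f2 /eqP f3].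
have ei : i = i' by apply: val_inj; rewrite /= -e1 -f1.
have ej : j = j' by apply: val_inj; rewrite /= -e2 -f2.
by rewrite e3 f3 ei ej.
Qed.

(** For an index in range the truncated subtraction loses nothing, so the
    index and the dimension of the meet determine each other. *)
Lemma C3_rel_dim i j l p : in_range C i j l ->
  (p \in cc_rel C i j l) =
  [&& \dim p.1 == i, \dim p.2 == j & \dim (p.1 :&: p.2) == (minn i j + eps i j - l)%N].
Proof.
rewrite C3_relE /in_range cc_maxE => lr.
case: eqP => //= d1; case: eqP => //= d2.
have [] := cap_dim_bounds p.1 p.2; rewrite d1 d2.
by move: (eps i j) lr (\dim _) => e lr d; lia.
Qed.

Definition GLact (g : 'End('rV[F]_n)) (p : X * X) : X * X :=
  ((g @: p.1)%VS, (g @: p.2)%VS).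

Lemma limg_dim (g : 'End('rV[F]_n)) U : lker g == 0%VS -> \dim (g @: U) = \dim U.
Proof. by move=> /eqP kg; apply: limg_dim_eq; rewrite kg capv0. Qed.

Lemma limg_bij (g : 'End('rV[F]_n)) : lker g == 0%VS -> bijective (lfun_img g : X -> X).
Proof. by move=> kg; apply: injF_bij => U V /eqP; rewrite eq_limg_ker0 // => /eqP. Qed.

Lemma C3_rel_GL g i j l p : lker g == 0%VS ->
  (GLact g p \in cc_rel C i j l) = (p \in cc_rel C i j l).
Proof. by move=> kg; rewrite !C3_relE /= -lker0_img_cap // !limg_dim. Qed.

(** The relations are single orbits of the linear group on pairs. *)
Lemma C3_rel_transitive i j l p p' : in_range C i j l ->
  p \in cc_rel C i j l -> p' \in cc_rel C i j l ->
  exists2 g, lker g == 0%VS & p' = GLact g p.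
Proof.
case: p p' => [U V] [U' V'] lr; rewrite !C3_rel_dim //=.
case/and3P=> /eqP e1 /eqP e2 /eqP e3 /and3P[/eqP f1 /eqP f2 /eqP f3].
have [||| g [kg <- <-]] := @GL_transitive _ _ U V U' V'; rewrite ?e1 ?e2 ?e3 //.
by exists g.
Qed.

Lemma cc_relationsP S : reflect (exists i j l, in_range C i j l /\ S = cc_rel C i j l)
  (S \in cc_relations C).
Proof.
rewrite inE; apply: (iffP existsP) => [[i /existsP[j /existsP[l /andP[lr /eqP->]]]]|].
  by exists i, j, l.
move=> [i [j [l [lr ->]]]]; exists i; apply/existsP; exists j; apply/existsP.
have lm : (l < (cc_max C i j).+1)%N by case/andP: lr.
by exists (Ordinal lm); rewrite lr /=.
Qed.

Lemma C3_coherent : coherent_configuration (cc_relations C).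
Proof.
split.
- by apply/card_gt0P; exists 0%VS.
- apply/and3P; split.
  + apply/eqP/setP => p; rewrite inE; apply/bigcupP.
    have [i [j [l [lr pr]]]] := C3_rel_cover p.
    by exists (cc_rel C i j l) => //; apply/cc_relationsP; exists i, j, l.
  + apply/trivIsetP => R S /cc_relationsP[i [j [l [lr ->]]]].
    move=> /cc_relationsP[i' [j' [l' [lr' ->]]]]; apply: contraNT.
    rewrite -setI_eq0 => /set0Pn[p /setIP[p1 p2]].
    by have [-> -> ->] := C3_rel_inj p1 p2.
  + apply/negP => /cc_relationsP[i [j [l [lr e]]]].
    by have [p] := C3_rel_exists lr; rewrite -e inE.
- move=> R /cc_relationsP[i [j [l [lr ->]]]] /set0Pn[[U V] /setIP[]].
  rewrite C3_rel_dim //= => /and3P[/eqP dU /eqP dV /eqP dc].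
  rewrite inE /= => /andP[/eqP eUV _].
  have eij : i = j by apply: val_inj; rewrite /= -dU -dV eUV.
  apply/subsetP => -[U' V']; rewrite C3_rel_dim //= => /and3P[/eqP dU' /eqP dV' /eqP dc'].
  rewrite inE /= inE andbT.
  move: dc'; rewrite -dc -eUV capvv dU => dc'.
  have e1 : (U' :&: V' = U')%VS by apply/eqP; rewrite eqEdim capvSl dc' dU' leqnn.
  have e2 : (U' :&: V' = V')%VS by apply/eqP; rewrite eqEdim capvSr dc' dV' -eij leqnn.
  by rewrite -e1 e2.
- move=> R /cc_relationsP[i [j [l [lr ->]]]]; apply/cc_relationsP.
  exists j, i, l; split.
    by rewrite /in_range cc_maxE minnC maxnC eps_sym minnC (minnC j) -cc_maxE.
  apply/setP => p; rewrite inE !C3_relE /= capvC minnC eps_sym.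
  by case: eqP => _; case: eqP.
- move=> R S T /cc_relationsP[i1 [j1 [l1 [lr1 ->]]]] /cc_relationsP[i2 [j2 [l2 [lr2 ->]]]].
  move=> /cc_relationsP[i3 [j3 [l3 [lr3 ->]]]] p p' pR p'R.
  have [g kg ->] := C3_rel_transitive lr3 pR p'R.
  rewrite /intersection_number /=.
  (* [g] permutes the subspaces counted by the two intersection numbers *)
  rewrite -[RHS](on_card_preimset (onW_bij _ (limg_bij kg))).
  apply: eq_card => z; rewrite !inE /=.
  exact: esym (congr2 andb
    (C3_rel_GL i1 j1 l1 (p.1, z) kg) (C3_rel_GL i2 j2 l2 (z, p.2) kg)).
Qed.

Lemma C3_numbered : numbered_coherent_configuration C.
Proof.
split.
- exact: C3_coherent.
- move=> i j; split; first by rewrite cc_maxE leq_addl.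
  move=> l lr; apply/subsetP => p; rewrite C3_relE !inE => /and3P[-> ->] //.
- move=> i; apply/setP => -[U V]; rewrite C3_relE !inE /= /eps eqxx addn0 minnn.
  apply/and3P/andP => [[/eqP dU /eqP dV e]|[/eqP-> /eqP dV]].
    have [] := cap_dim_bounds U V; rewrite dU dV minnn => le _.
    have {}e : \dim (U :&: V) = i by lia.
    have e1 : (U :&: V = U)%VS by apply/eqP; rewrite eqEdim capvSl dU e leqnn.
    have e2 : (U :&: V = V)%VS by apply/eqP; rewrite eqEdim capvSr dV e leqnn.
    have eUV : U = V by rewrite -e1.
    by split; apply/eqP.
  by rewrite capvv dV subnn !eqxx.
- move=> i j l _; apply/setP => p; rewrite inE !C3_relE /= capvC minnC eps_sym.
  by case: eqP => _; case: eqP.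
- move=> i j l i' j' l' lr lr' e; have [p p1] := C3_rel_exists lr.
  by apply: (C3_rel_inj p1); rewrite -e.
Qed.

(** * Matrices invariant under the linear group *)

Variable K : numClosedFieldType.
Local Notation M := 'M[K]_#|{: {vspace 'rV[F]_n}}|.
Local Notation adj := (adj C K).
Implicit Types A B : M.

Definition GL_invariant A : Prop := forall g : 'End('rV[F]_n), lker g == 0%VS ->
  forall U V, ent A (g @: U)%VS (g @: V)%VS = ent A U V.

Lemma invariantB A B : GL_invariant A -> GL_invariant B -> GL_invariant (A - B).
Proof. by move=> hA hB g kg U V; rewrite !entB hA ?hB. Qed.

Lemma invariantZ c A : GL_invariant A -> GL_invariant (c *: A).
Proof. by move=> hA g kg U V; rewrite !entZ hA. Qed.

Lemma invariant_tr A : GL_invariant A -> GL_invariant A^T.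
Proof. by move=> hA g kg U V; rewrite !ent_tr hA. Qed.

Lemma invariant_mul A B : GL_invariant A -> GL_invariant B -> GL_invariant (A *m B).
Proof.
move=> hA hB g kg U V; rewrite !ent_mul (reindex (lfun_img g)) /=.
  by apply: eq_bigr => W _; rewrite hA ?hB.
exact: onW_bij (limg_bij kg).
Qed.

Definition in_block i j A : Prop :=
  forall U V, ent A U V != 0 -> \dim U = i /\ \dim V = j.

Lemma ent_adj i j l U V : ent (adj i j l) U V = ((U, V) \in cc_rel C i j l)%:R.
Proof. by rewrite /ent mxE !enum_rankK. Qed.

Lemma invariant_adj i j l : GL_invariant (adj i j l).
Proof. by move=> g kg U V; rewrite !ent_adj (C3_rel_GL i j l (U, V) kg). Qed.

Lemma in_block_adj i j l : in_block i j (adj i j l).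
Proof.
move=> U V; rewrite ent_adj C3_relE.
by case: and3P => [[/eqP-> /eqP-> _] //|_]; rewrite eqxx.
Qed.

Lemma in_block_mul i j k A B : in_block i j A -> in_block j k B -> in_block i k (A *m B).
Proof.
move=> hA hB U V nz.
have /existsP[W] : [exists W, ent A U W * ent B W V != 0].
  apply: contraNT nz => /existsPn h; rewrite ent_mul big1 // => W _.
  by apply/eqP; rewrite -[_ == _]negbK h.
by rewrite mulf_eq0 negb_or => /andP[/hA[-> _] /hB[_ ->]].
Qed.

(** The coefficient of the [l]-th relation is the common value of the matrix on
    that relation, because the linear group is transitive on it. *)
Lemma invariant_decomp i j A : GL_invariant A -> in_block i j A ->
  exists m : nat -> K,
    A = \sum_(eps i j <= l < (cc_max C i j).+1) m l *: adj i j l /\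
    forall l p, in_range C i j l -> p \in cc_rel C i j l -> m l = ent A p.1 p.2.
Proof.
move=> iA bA.
pose m l := if [pick p in cc_rel C i j l] is Some p then ent A p.1 p.2 else 0.
have mP l p : in_range C i j l -> p \in cc_rel C i j l -> m l = ent A p.1 p.2.
  move=> lr pR; rewrite /m; case: pickP => [p' p'R|/(_ p)]; last by rewrite pR.
  by have [g kg ->] := C3_rel_transitive lr pR p'R; rewrite iA.
exists m; split=> //; apply: entP => U V; rewrite ent_sum.
have [i' [j' [l [lr UVR]]]] := C3_rel_cover (U, V).
have [bij|nbij] := boolP ((i' == i) && (j' == j)).
  case/andP: bij => /eqP ei /eqP ej; subst i' j'.
  rewrite (bigD1_seq l) ?iota_uniq //=; last first.
    by rewrite mem_index_iota ltnS.
  rewrite entZ ent_adj UVR mulr1 big1 ?addr0 ?(mP _ _ lr UVR) // => l' ll'.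
  rewrite entZ ent_adj; case: ((U, V) \in _) / boolP => [UVR'|]; last by rewrite mulr0.
  by have [_ _ e] := C3_rel_inj UVR UVR'; rewrite e eqxx in ll'.
move: UVR; rewrite C3_relE => /and3P[/eqP /= dU /eqP /= dV _].
have nU B : in_block i j B -> ent B U V = 0.
  move=> bB; apply: contraNeq nbij => /bB[]; rewrite dU dV => eU eV.
  by apply/andP; split; apply/eqP/val_inj.
by rewrite (nU _ bA) big1 // => l' _; rewrite entZ (nU _ (@in_block_adj _ _ _)) mulr0.
Qed.

Lemma mem_adj_space i j A : GL_invariant A -> in_block i j A -> A \in adj_space C K i j.
Proof.
move=> iA bA; have [m [-> _]] := invariant_decomp iA bA.
rewrite big_seq_cond; apply: rpred_sum => l; rewrite andbT => lr; apply: rpredZ.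
by apply: memv_span; apply: map_f.
Qed.

End SubspaceConfigurationTheory.

(** * The up and down operators *)

Section Operators.
Variables (F : finFieldType) (n : nat) (K : numClosedFieldType).
Local Notation X := {vspace 'rV[F]_n}.
Local Notation M := 'M[K]_#|{: {vspace 'rV[F]_n}}|.
Local Notation qint := (qint F).
Implicit Types (U V W : X) (A B : M).

Definition levelmx (i : nat) : M := mx_of (fun U V => ((U == V) && (\dim U == i))%:R).
Definition downmx : M := mx_of (fun U V => (covers U V)%:R).
Definition upmx : M := downmx^T.

Lemma ent_levelM i A U V : ent (levelmx i *m A) U V = (\dim U == i)%:R * ent A U V.
Proof.
rewrite ent_mul (bigD1 U) //= ent_mx_of eqxx big1 ?addr0 // => W WU.
by rewrite ent_mx_of eq_sym (negPf WU) mul0r.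
Qed.

Lemma level_tr i : (levelmx i)^T = levelmx i.
Proof.
apply: entP => U V; rewrite ent_tr !ent_mx_of eq_sym.
by case: eqP => // ->.
Qed.

Lemma ent_Mlevel i A U V : ent (A *m levelmx i) U V = (\dim V == i)%:R * ent A U V.
Proof. by rewrite -(trmxK (A *m _)) trmx_mul level_tr ent_tr ent_levelM ent_tr. Qed.

Lemma levelM i : levelmx i *m levelmx i = levelmx i.
Proof.
apply: entP => U V; rewrite ent_levelM ent_mx_of.
by case: (\dim U == i); rewrite ?mul1r ?andbF ?mulr0.
Qed.

Lemma down_level i : downmx *m levelmx i.+1 = levelmx i *m downmx.
Proof.
apply: entP => U V; rewrite ent_Mlevel ent_levelM ent_mx_of.
rewrite /covers; case: (_ <= _)%VS; rewrite ?mulr0 //=.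
by case: (\dim V =P (\dim U).+1) => [->|_]; rewrite ?eqSS ?mulr0.
Qed.

Lemma down_level0 : downmx *m levelmx 0 = 0.
Proof.
apply: entP => U V; rewrite ent_Mlevel !ent_mx_of /covers /ent mxE.
by case: (\dim V =P 0%N) => [->|_]; rewrite ?andbF ?mulr0 ?mul0r.
Qed.

Lemma up_level i : upmx *m levelmx i = levelmx i.+1 *m upmx.
Proof. by rewrite -[LHS]trmxK trmx_mul level_tr trmxK -down_level trmx_mul level_tr. Qed.

Lemma up_down_level i : upmx *m downmx *m levelmx i = levelmx i *m (upmx *m downmx).
Proof.
case: i => [|i]; last by rewrite -mulmxA down_level !mulmxA up_level.
rewrite -mulmxA down_level0 mulmx0; apply: trmx_inj.
by rewrite trmx0 !trmx_mul level_tr trmxK -mulmxA down_level0 mulmx0.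
Qed.

Definition comm_scalar (i : nat) : K := (qint (n - i))%:R - (qint i)%:R.

Lemma ent_downup U V : ent (downmx *m upmx) U V = #|[set W | covers U W && covers V W]|%:R.
Proof.
rewrite ent_mul -sum1_card natr_sum [RHS]big_mkcond /=; apply: eq_bigr => W _.
by rewrite ent_tr !ent_mx_of inE; do 2 case: covers; rewrite ?mul1r ?mul0r.
Qed.

Lemma ent_updown U V : ent (upmx *m downmx) U V = #|[set W | covers W U && covers W V]|%:R.
Proof.
rewrite ent_mul -sum1_card natr_sum [RHS]big_mkcond /=; apply: eq_bigr => W _.
by rewrite ent_tr !ent_mx_of inE; do 2 case: covers; rewrite ?mul1r ?mul0r.
Qed.

(** The entries of the two products count common upper and common lower
    covers.  Off the diagonal these counts agree; on the diagonal they are the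
    upper and lower degrees. *)
Lemma downup_comm i :
  downmx *m upmx *m levelmx i = upmx *m downmx *m levelmx i + comm_scalar i *: levelmx i.
Proof.
apply: entP => U V; rewrite entD entZ !ent_Mlevel ent_downup ent_updown ent_mx_of.
have [dV|dV] := eqVneq (\dim V) i; last first.
  rewrite !mul0r add0r; case: eqP => [->|]; rewrite ?(negPf dV) ?mulr0 //.
rewrite !mul1r; have [->|UV] := eqVneq U V.
  rewrite dV eqxx mulr1 /comm_scalar -dV -card_upper_covers -card_lower_covers.
  have diag (P : pred X) : [set W | P W && P W] = [set W | P W].
    by apply/setP => W; rewrite !inE andbb.
  by rewrite !diag addrC subrK.
rewrite mulr0 addr0; congr _%:R.
have [dUV|dUV] := eqVneq (\dim U) (\dim V).
  have [c|c] := boolP ((\dim (U :&: V)).+1 == \dim U).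
    rewrite (_ : [set W | _] = [set (U + V)%VS]) ?cards1; last first.
      by apply/setP => W; rewrite !inE covers_joinP // c.
    rewrite (_ : [set W | _] = [set (U :&: V)%VS]) ?cards1 //.
    by apply/setP => W; rewrite !inE covers_meetP // c.
  rewrite (_ : [set W | _] = set0) ?cards0; last first.
    by apply/setP => W; rewrite !inE covers_joinP // (negPf c).
  rewrite (_ : [set W | _] = set0) ?cards0 //.
  by apply/setP => W; rewrite !inE covers_meetP // (negPf c).
rewrite (_ : [set W | _] = set0) ?cards0; last first.
  apply/setP => W; rewrite !inE; apply: contraNF dUV.
  by case/andP=> /andP[_ /eqP e1] /andP[_ /eqP e2]; rewrite -eqSS -e1 e2.
rewrite (_ : [set W | _] = set0) ?cards0 //.
apply/setP => W; rewrite !inE; apply: contraNF dUV.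
by case/andP=> /andP[_ /eqP e1] /andP[_ /eqP e2]; rewrite e1 e2.
Qed.

(** Count the covering pairs between the two levels in two ways: below the
    middle, the upper degree of the lower level exceeds the lower degree of the
    upper one. *)
Lemma card_level_lt h : (h.+1.*2 <= n)%N ->
  (#|[set U : X | \dim U == h]| < #|[set U : X | \dim U == h.+1]|)%N.
Proof.
move=> hn; set a := #|_|; set b := #|_|.
have ab : (a * qint (n - h) = b * qint h.+1)%N.
  transitivity (\sum_(U : X | \dim U == h) \sum_(V : X | \dim V == h.+1) covers U V)%N.
    rewrite -sum_nat_const [LHS](eq_bigl (fun U : X => \dim U == h)); last first.
      by move=> U; rewrite inE.
    apply: eq_bigr => U /eqP dU; rewrite -dU -card_upper_covers -sum1_card.
    rewrite big_mkcond [RHS]big_mkcond; apply: eq_bigr => V _; rewrite inE /covers.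
    by case: (_ <= _)%VS => //=; case: (_ == _).
  rewrite exchange_big -sum_nat_const /=.
  rewrite [RHS](eq_bigl (fun U : X => \dim U == h.+1)) /=; last first.
    by move=> U; rewrite inE.
  apply: eq_bigr => V /eqP dV; rewrite -dV -card_lower_covers -sum1_card.
  rewrite big_mkcond [RHS]big_mkcond; apply: eq_bigr => U _; rewrite inE /covers.
  case: (_ <= _)%VS => /=; last by case: ifP.
  by rewrite dV eqSS eq_sym; case: (_ == _).
have q12 : (qint h.+1 < qint (n - h))%N by rewrite ltn_qint; lia.
have a0 : (0 < a)%N.
  apply/card_gt0P; have [||U [V [dU _ _]]] := @exists_pair_dim F 'rV[F]_n h h h.
  - by rewrite minnn.
  - by rewrite dim_rV; lia.
  by exists U; rewrite inE dU.
rewrite ltnNge; apply/negP => ba.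
have : (a * qint h.+1 < b * qint h.+1)%N by rewrite -ab ltn_pmul2l.
by rewrite ltnNge leq_mul2r ba orbT.
Qed.

Lemma rank_level i : \rank (levelmx i) = #|[set U : X | \dim U == i]|.
Proof.
apply/eqP; rewrite -(eqr_nat K) -mxtrace_idempotent ?levelM //; apply/eqP.
rewrite -sum1_card natr_sum big_mkcond /=.
rewrite [RHS](reindex (@enum_val X predT)) /=; last first.
  by exists enum_rank => ? _; rewrite ?enum_rankK ?enum_valK.
by apply: eq_bigr => a _; rewrite mxE eqxx inE /=; case: eqP.
Qed.

Lemma level_neq0 i : (i <= n)%N -> levelmx i != 0.
Proof.
move=> lin; rewrite -mxrank_eq0 rank_level -lt0n; apply/card_gt0P.
have [||U [V [dU _ _]]] := @exists_pair_dim F 'rV[F]_n i i i.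
- by rewrite minnn.
- by rewrite dim_rV addnK.
by exists U; rewrite inE dU.
Qed.

(** [comm_sum h k] is the eigenvalue of [upmx *m downmx] on the part of level
    [k] that is raised from the harmonic functions of level [h], and
    [comm_sum h k.+1] that of [downmx *m upmx]. *)
Definition comm_sum (h k : nat) : K := \sum_(h <= j < k) comm_scalar j.

Lemma comm_sum_nil h : comm_sum h h = 0.
Proof. by rewrite /comm_sum big_geq. Qed.

Lemma comm_sumS h k : (h <= k)%N -> comm_sum h k.+1 = comm_sum h k + comm_scalar k.
Proof. by move=> hk; rewrite /comm_sum big_nat_recr. Qed.

(** Reversing the order of the first terms pairs the [q]-integer of [j] with
    that of a number larger than [j]. *)
Lemma comm_sum_gt0 h k : (h < k)%N -> (h + k <= n)%N -> 0 < comm_sum h k.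
Proof.
move=> hk hkn.
have -> : comm_sum h k = \sum_(h <= j < k) ((qint (n - (h + k - j.+1)))%:R - (qint j)%:R).
  by rewrite /comm_sum /comm_scalar big_split [in RHS]big_split /= [X in X + _ = _]big_nat_rev.
have pos j : (h <= j < k)%N ->
  0 < (qint (n - (h + k - j.+1)))%:R - (qint j)%:R :> K.
  by move=> hj; rewrite subr_gt0 ltr_nat ltn_qint; lia.
rewrite big_ltn // ltr_wpDr ?pos ?leqnn //.
by rewrite big_nat_cond sumr_ge0 // => j /andP[hj _]; apply/ltW/pos; lia.
Qed.

(** * Harmonic projectors *)

(** The product of the factors [1 - (comm_sum k h)^-1 UD] for [k < m], applied
    to level [h].  The factor of index [k] kills the part of level [h] that is
    raised from the harmonic functions of level [k], and every factor fixes the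
    harmonic functions of level [h]; with all [k < h], what is left is the
    projector on the latter. *)
Fixpoint pre_harmonic (m h : nat) : M :=
  if m is m'.+1 then
    pre_harmonic m' h - (comm_sum m' h)^-1 *: (upmx *m downmx *m pre_harmonic m' h)
  else levelmx h.

Definition harmonic (h : nat) : M := pre_harmonic h h.

Lemma comm_sum_neq0 h k : (h < k)%N -> (h + k <= n)%N -> comm_sum h k != 0.
Proof. by move=> hk hkn; rewrite gt_eqF // comm_sum_gt0. Qed.

Lemma level_pre_harmonic m h : levelmx h *m pre_harmonic m h = pre_harmonic m h.
Proof.
elim: m => [|m IH] /=; first exact: levelM.
by rewrite mulmxBr IH -scalemxAr mulmxA -up_down_level -(mulmxA (upmx *m downmx)) IH.
Qed.

Lemma pre_harmonic_comm m h :
  pre_harmonic m h *m (upmx *m downmx) = upmx *m downmx *m pre_harmonic m h.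
Proof.
elim: m => [|m IH] /=; first by rewrite up_down_level.
by rewrite mulmxBl mulmxBr -scalemxAl -scalemxAr -(mulmxA (upmx *m downmx)) IH.
Qed.

Lemma pre_harmonic_tr m h : (pre_harmonic m h)^T = pre_harmonic m h.
Proof.
elim: m => [|m IH] /=; first exact: level_tr.
rewrite linearB linearZ /= !trmx_mul IH.
by rewrite /upmx trmxK -/upmx pre_harmonic_comm.
Qed.

(** Moving [downmx] through a factor turns [UD] into [DU], that is [UD] shifted
    by the commutation scalar of level [h]: up to a constant, this is the factor
    of the same index one level below. *)
Lemma down_pre_harmonic m h : (m <= h)%N -> (m + h.+1 <= n)%N ->
  exists c, downmx *m pre_harmonic m h.+1 = c *: (pre_harmonic m h *m downmx).
Proof.
elim: m => [|m IH] mh mn; first by exists 1; rewrite scale1r /= down_level.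
have [||c e] := IH; try lia.
exists (c * (comm_sum m h.+1)^-1 * comm_sum m h) => /=.
have DU : downmx *m upmx *m pre_harmonic m h
          = upmx *m downmx *m pre_harmonic m h + comm_scalar h *: pre_harmonic m h.
  by rewrite -(level_pre_harmonic m h) !mulmxA downup_comm mulmxDl -scalemxAl.
rewrite mulmxBr -scalemxAr !mulmxA -(mulmxA (downmx *m upmx)) e -!scalemxAr mulmxA DU.
rewrite mulmxBl mulmxDl -!scalemxAl scalerBr !scalerDr !scalerA.
have s1 : comm_sum m h.+1 != 0 by apply: comm_sum_neq0; lia.
have s2 : comm_sum m h != 0 by apply: comm_sum_neq0; lia.
move: (pre_harmonic m h *m downmx) (upmx *m downmx *m _ *m _) => A B.
have -> : comm_scalar h = comm_sum m h.+1 - comm_sum m h.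
  by rewrite comm_sumS 1?addrC ?addKr //; lia.
by apply/matrixP => a b; rewrite !mxE; field; rewrite s1 s2.
Qed.

(* the functions in the range of [harmonic h] are the harmonic ones *)
(** At level [h.+1] the last factor, of index [h], has no counterpart one level
    below: the shift turns it into a multiple of [UD], which the harmonic
    projector of level [h] kills by induction. *)
Lemma down_harmonic h : (h.*2 <= n)%N -> downmx *m harmonic h = 0.
Proof.
elim: h => [|h IH] hn; first exact: down_level0.
have [||c e] := @down_pre_harmonic h h; try lia.
have DG : downmx *m harmonic h = 0 by apply: IH; lia.
rewrite /harmonic /= mulmxBr -scalemxAr !mulmxA -(mulmxA (downmx *m upmx)) e.
have DU : downmx *m upmx *m harmonic h = comm_scalar h *: harmonic h.
  by rewrite /harmonic -(level_pre_harmonic h h) !mulmxA downup_comm mulmxDl -scalemxAl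
    -mulmxA -(mulmxA upmx) level_pre_harmonic DG mulmx0 add0r.
rewrite -/(harmonic h) -scalemxAr mulmxA DU -scalemxAl !scalerA -scalerBl.
have s0 : comm_sum h h.+1 = comm_scalar h by rewrite comm_sumS // comm_sum_nil add0r.
have sn0 : comm_scalar h != 0 by rewrite -s0; apply: comm_sum_neq0; lia.
by rewrite s0 mulrAC mulVf // mul1r subrr scale0r.
Qed.

Lemma harmonic_tr h : (harmonic h)^T = harmonic h.
Proof. exact: pre_harmonic_tr. Qed.

Lemma level_harmonic h : levelmx h *m harmonic h = harmonic h.
Proof. exact: level_pre_harmonic. Qed.

Lemma harmonic_up h : (h.*2 <= n)%N -> harmonic h *m upmx = 0.
Proof. by move=> hn; rewrite -harmonic_tr -trmx_mul down_harmonic // trmx0. Qed.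

Lemma harmonic_idem h : (h.*2 <= n)%N -> harmonic h *m harmonic h = harmonic h.
Proof.
move=> hn; have step m : pre_harmonic m h *m harmonic h = harmonic h.
  elim: m => [|m IH]; first exact: level_harmonic.
  rewrite /= mulmxBl IH -scalemxAl -(mulmxA (upmx *m downmx)) IH -mulmxA down_harmonic //.
  by rewrite mulmx0 scaler0 subr0.
exact: step.
Qed.

(** If the projector vanished, the identity of level [h.+1] would factor through
    level [h], which has smaller rank. *)
Lemma harmonic_neq0 h : (h.*2 <= n)%N -> harmonic h != 0.
Proof.
case: h => [|h] hn; first exact: level_neq0.
have complement m : exists S,
    pre_harmonic m h.+1 = levelmx h.+1 - S *m (downmx *m levelmx h.+1).
  elim: m => [|m [S IH]]; first by exists 0; rewrite mul0mx subr0.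
  exists (S + (comm_sum m h.+1)^-1 *: (upmx - upmx *m downmx *m S)) => /=.
  by rewrite IH mulmxDl -scalemxAl mulmxBl (mulmxBr (upmx *m downmx)) -!mulmxA opprD addrA.
have [S e] := complement h.+1.
apply: contraTneq (card_level_lt hn) => p0.
rewrite -leqNgt -!rank_level.
have -> : levelmx h.+1 = S *m (levelmx h *m downmx).
  by apply/eqP; rewrite -down_level -subr_eq0 -e -/(harmonic _) p0.
by rewrite mulmxA (leq_trans (mxrankM_maxl _ _)) // mxrankM_maxr.
Qed.

Definition raise (k h : nat) : M := iter k (mulmx upmx) (harmonic h).

Lemma raise0 h : raise 0 h = harmonic h. Proof. by []. Qed.

Lemma raiseS k h : raise k.+1 h = upmx *m raise k h. Proof. by []. Qed.

Lemma level_raise k h : levelmx (h + k) *m raise k h = raise k h.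
Proof.
elim: k => [|k IH]; first by rewrite addn0 level_harmonic.
by rewrite addnS /= mulmxA -up_level -mulmxA IH.
Qed.

Lemma down_raise k h : (h.*2 <= n)%N ->
  downmx *m raise k.+1 h = comm_sum h (h + k.+1) *: raise k h.
Proof.
move=> hn; have DU m : downmx *m raise m.+1 h
    = upmx *m (downmx *m raise m h) + comm_scalar (h + m) *: raise m h.
  rewrite -{1}[raise m.+1 h]/(upmx *m raise m h) -{1}(level_raise m h) !mulmxA downup_comm.
  by rewrite mulmxDl -scalemxAl -(mulmxA (upmx *m downmx)) level_raise.
elim: k => [|k IH]; rewrite DU.
  by rewrite down_harmonic // mulmx0 add0r addn1 comm_sumS // comm_sum_nil add0r addn0.
have UR : upmx *m raise k h = raise k.+1 h by [].
by rewrite IH -scalemxAr UR -scalerDl -comm_sumS ?leq_addr // !addnS.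
Qed.

(** The factor by which raising [k] times from level [h] multiplies the square
    of the norm of a harmonic function. *)
Definition raise_factor (h k : nat) : K := \prod_(t < k) comm_sum h (h + t.+1).

Lemma iter_down_raise k m h : (h.*2 <= n)%N ->
  iter k (mulmx downmx) (raise (m + k) h) =
  (\prod_(t < k) comm_sum h (h + (m + t).+1)) *: raise m h.
Proof.
move=> hn; elim: k => [|k IH]; first by rewrite big_ord0 scale1r addn0.
rewrite iterSr addnS down_raise // big_ord_recr /= mulrC -scalerA -IH.
elim: k {IH} (raise _ h) (comm_sum _ _) => //= k IH A c.
by rewrite IH scalemxAr.
Qed.

Lemma raise_tr_mul k h A : (raise k h)^T *m A = harmonic h *m iter k (mulmx downmx) A.
Proof.
elim: k A => [|k IH] A; first by rewrite harmonic_tr.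
by rewrite iterSr -IH /= trmx_mul trmxK mulmxA.
Qed.

Lemma raise_norm k h : (h.*2 <= n)%N ->
  (raise k h)^T *m raise k h = raise_factor h k *: harmonic h.
Proof.
move=> hn; rewrite raise_tr_mul -[X in raise X]add0n iter_down_raise //.
by rewrite -scalemxAr harmonic_idem.
Qed.

(** Strings that start at different levels are orthogonal: lowering the one
    that starts deeper to the starting level of the other leaves a raised
    function, which the harmonic projector kills. *)
Lemma raise_orth k h k' h' : (h.*2 <= n)%N -> (h'.*2 <= n)%N ->
  (h + k = h' + k')%N -> h != h' -> (raise k h)^T *m raise k' h' = 0.
Proof.
wlog hh : k h k' h' / (h' < h)%N => [IH hn hn' e|hn hn' e _].
  rewrite neq_ltn => /orP[lt|lt]; last by apply: IH => //; rewrite gtn_eqF.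
  rewrite -[LHS]trmxK trmx_mul trmxK IH ?trmx0 // ?(esym e) //.
  by rewrite gtn_eqF.
have -> : k' = ((k' - k).-1.+1 + k)%N by lia.
rewrite raise_tr_mul iter_down_raise // -scalemxAr /= mulmxA harmonic_up //.
by rewrite mul0mx scaler0.
Qed.

Lemma raise_factor_neq0 h k : (h + (h + k) <= n)%N -> raise_factor h k != 0.
Proof.
move=> hk; apply/prodf_neq0 => t _; have := ltn_ord t => tk.
by apply: comm_sum_neq0; lia.
Qed.

End Operators.

(** * Matrix units *)

Section Eigenbases.
Variables (F : finFieldType) (n : nat) (K : numClosedFieldType).
Local Notation X := {vspace 'rV[F]_n}.
Local Notation C := (C3 F n).
Local Notation M := 'M[K]_#|{: {vspace 'rV[F]_n}}|.
Local Notation adj := (adj C K).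
Local Notation levelmx := (levelmx F n K).
Local Notation downmx := (downmx F n K).
Local Notation upmx := (upmx F n K).
Local Notation raise_factor := (raise_factor F n K).
Local Notation raise := (raise F n K).
Local Notation harmonic := (harmonic F n K).
Implicit Types (U V W : X) (A B : M) (i j : 'I_n.+1).

(** A string that starts at level [h] lives on the levels from [h] to [n - h];
    the indices [h] in range for the block (i, j) are those whose string meets
    both levels. *)
Lemma le_rtilde i j h : (h <= rtilde C i j)%N = [&& h <= i, h <= j, h + i <= n & h + j <= n]%N.
Proof. by rewrite rtildeE; have := ltn_ord i; have := ltn_ord j; lia. Qed.

Lemma level_orth (i j : nat) : i != j -> levelmx i *m levelmx j = 0.
Proof.
move=> ij; apply: entP => U V; rewrite ent_levelM ent_mx_of /ent mxE.
by case: eqP => [->|]; rewrite ?(negPf ij) ?andbF ?mulr0 ?mul0r.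
Qed.

Lemma level_raiseB h (i : nat) : (h <= i)%N -> levelmx i *m raise (i - h) h = raise (i - h) h.
Proof. by move=> hi; rewrite -{1}(subnKC hi) level_raise. Qed.

Lemma raise_harmonic k h : (h.*2 <= n)%N -> raise k h *m harmonic h = raise k h.
Proof.
by move=> hn; elim: k => [|k IH]; rewrite /= -?mulmxA ?IH // harmonic_idem.
Qed.

Definition raise_scale (h i : nat) : K := sqrtC (raise_factor h (i - h)).

(** The partial isometry from level [j] to level [i] along the strings that
    start at level [h]. *)
Definition eigmx i j (h : nat) : M :=
  (raise_scale h i * raise_scale h j)^-1 *: (raise (i - h) h *m (raise (j - h) h)^T).

Lemma raise_scale_neq0 h (i : nat) : (h <= i)%N -> (h + i <= n)%N -> raise_scale h i != 0.
Proof. by move=> hi hn; rewrite sqrtC_eq0 raise_factor_neq0 // subnKC. Qed.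

Lemma eigmx_tr i j h : (eigmx i j h)^T = eigmx j i h.
Proof. by rewrite /eigmx linearZ /= trmx_mul trmxK mulrC. Qed.

Lemma eigmx_mul i j l i' j' l' : (l <= rtilde C i j)%N -> (l' <= rtilde C i' j')%N ->
  eigmx i j l *m eigmx i' j' l' = ((j == i') && (l == l'))%:R *: eigmx i j' l.
Proof.
rewrite !le_rtilde => /and4P[li lj lin ljn] /and4P[li' lj' lin' ljn'].
have l2 : (l.*2 <= n)%N by lia.
have l2' : (l'.*2 <= n)%N by lia.
rewrite /eigmx -scalemxAl -scalemxAr scalerA mulmxA -(mulmxA (raise (i - l) l)).
case: (eqVneq j i') => [e|ne] /=; last first.
  rewrite -(level_raiseB lj) -(level_raiseB li') trmx_mul level_tr.
  rewrite -(mulmxA _ (levelmx j)) (mulmxA (levelmx j)) level_orth // mul0mx !mulmx0 mul0mx.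
  by rewrite scale0r scaler0.
subst i'; case: (eqVneq l l') => [e|ne]; last first.
  by rewrite raise_orth ?mulmx0 ?mul0mx ?scaler0 ?scale0r // !subnKC.
subst l'; rewrite raise_norm // -scalemxAr raise_harmonic // -scalemxAl scalerA scale1r.
congr (_ *: _); have := sqrtCK (raise_factor l (j - l)); rewrite -/(raise_scale l j) => <-.
have := raise_scale_neq0 li lin; have := raise_scale_neq0 lj ljn.
have := raise_scale_neq0 lj' ljn'.
by move=> a b c; field; rewrite a b c.
Qed.

Lemma eigmx_neq0 i j h : (h <= rtilde C i j)%N -> eigmx i j h != 0.
Proof.
rewrite le_rtilde => /and4P[hi hj hin hjn].
have h2 : (h.*2 <= n)%N by lia.
apply: contraTneq (harmonic_neq0 F K h2) => e0; rewrite negbK.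
have : (raise (i - h) h)^T *m eigmx i j h *m raise (j - h) h = 0.
  by rewrite e0 mulmx0 mul0mx.
rewrite -scalemxAr -scalemxAl !mulmxA raise_norm // -!mulmxA raise_norm //.
rewrite -scalemxAr -scalemxAl harmonic_idem // !scalerA => /eqP; rewrite scaler_eq0.
rewrite !mulf_eq0 invr_eq0 mulf_eq0.
rewrite (negPf (raise_scale_neq0 hi hin)) (negPf (raise_scale_neq0 hj hjn)).
by rewrite !(negPf (raise_factor_neq0 _ _ _)) // subnKC.
Qed.

Lemma invariant_level (i : nat) : GL_invariant (levelmx i).
Proof.
by move=> g kg U V; rewrite !ent_mx_of eq_limg_ker0 // limg_dim.
Qed.

Lemma invariant_down : GL_invariant downmx.
Proof.
by move=> g kg U V; rewrite !ent_mx_of /covers limg_ker0 // !limg_dim.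
Qed.

Lemma invariant_up : GL_invariant upmx.
Proof. exact: invariant_tr invariant_down. Qed.

Lemma invariant_pre_harmonic m h : GL_invariant (pre_harmonic F n K m h).
Proof.
elim: m => [|m IH]; first exact: invariant_level.
apply: invariantB => //; apply: invariantZ; apply: invariant_mul => //.
exact: invariant_mul invariant_up invariant_down.
Qed.

Lemma invariant_raise k h : GL_invariant (raise k h).
Proof.
elim: k => [|k IH]; last exact: invariant_mul invariant_up IH.
exact: invariant_pre_harmonic.
Qed.

Lemma invariant_eigmx i j h : GL_invariant (eigmx i j h).
Proof.
apply: invariantZ; apply: invariant_mul; first exact: invariant_raise.
exact/invariant_tr/invariant_raise.
Qed.

Lemma in_block_eigmx i j h : (h <= i)%N -> (h <= j)%N -> in_block i j (eigmx i j h).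
Proof.
move=> hi hj U V.
have -> : eigmx i j h = levelmx i *m eigmx i j h *m levelmx j.
  rewrite -scalemxAr -scalemxAl !mulmxA level_raiseB //; congr (_ *: _).
  by rewrite -mulmxA -[levelmx j]level_tr -trmx_mul level_raiseB.
rewrite ent_Mlevel ent_levelM; case: (\dim V =P j) => [->|_]; last by rewrite mul0r eqxx.
by case: (\dim U =P i) => [->|_] //; rewrite mul0r mulr0 eqxx.
Qed.

Lemma nth_E_tuple (E : 'I_n.+1 -> 'I_n.+1 -> nat -> M) i j (h : 'I_(rtilde C i j).+1) :
  (E_tuple C E i j)`_h = E i j h.
Proof. by rewrite -tnth_nth tnth_mktuple. Qed.

Lemma eigmx_basis i j : basis_of (adj_space C K i j) (E_tuple C eigmx i j).
Proof.
rewrite basisEfree; apply/and3P; split.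
- apply/freeP => c c0 h.
  have hr : (h <= rtilde C i j)%N by rewrite -ltnS.
  have hr' : (h <= rtilde C j i)%N by move: hr; rewrite !le_rtilde => /and4P[-> -> -> ->].
  have : eigmx j i h *m \sum_(l < (rtilde C i j).+1) c l *: eigmx i j l = 0.
    rewrite -[X in _ *m X = _](_ : 0 = _) ?mulmx0 // -[LHS]c0.
    by apply: eq_bigr => l _; rewrite nth_E_tuple.
  rewrite mulmx_sumr (bigD1 h) //= big1 ?addr0 => [|l lh].
    rewrite -scalemxAr eigmx_mul // !eqxx scale1r.
    have hjj : (h <= rtilde C j j)%N by move: hr; rewrite !le_rtilde => /and4P[_ -> _ ->].
    by move/eqP; rewrite scaler_eq0 (negPf (eigmx_neq0 hjj)) orbF => /eqP.
  have lr : (l <= rtilde C i j)%N by rewrite -ltnS.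
  rewrite -scalemxAr eigmx_mul //.
  have /negPf hl : h != l :> nat by rewrite eq_sym.
  by rewrite hl andbF scale0r scaler0.
- apply/span_subvP => A /tnthP[h ->]; rewrite tnth_mktuple.
  have : (h <= rtilde C i j)%N by rewrite -ltnS.
  rewrite le_rtilde => /and4P[hi hj _ _].
  apply: mem_adj_space; first exact: invariant_eigmx.
  exact: in_block_eigmx.
- rewrite size_tuple (leq_trans (dim_span _)) // size_map size_iota.
  by rewrite /rtilde subSn // cc_maxE leq_addl.
Qed.

Lemma raise0_ge0 k U V : 0 <= ent (raise k 0) U V.
Proof.
elim: k U V => [|k IH] U V; first by rewrite raise0 ent_mx_of ler0n.
rewrite raiseS ent_mul sumr_ge0 // => W _.
by rewrite mulr_ge0 ?IH // ent_tr ent_mx_of ler0n.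
Qed.

(** A constant function on level [0] is raised to a constant function on level
    [k], so its norm gives [raise_factor 0 k] as a square times the size of the
    level.  The entry is nonnegative, which fixes the sign of the root. *)
Lemma raise0E k U : (k <= n)%N -> \dim U = k ->
  ent (raise k 0) U 0%VS * sqrtC #|[set W : X | \dim W == k]|%:R = raise_scale 0 k.
Proof.
move=> kn dU; set c := ent _ _ _.
have cE W : ent (raise k 0) W 0%VS = (\dim W == k)%:R * c.
  rewrite -{1}(level_raise F n K k 0) add0n ent_levelM; case: eqP => [dW|]; last by rewrite !mul0r.
  have [||| g [kg gU g0]] := @GL_transitive _ _ U 0%VS W 0%VS; rewrite ?cap0v ?capv0 ?dU //.
  by rewrite !mul1r /c -[RHS](invariant_raise k 0 kg) gU g0.
have gE : raise_factor 0 k = c ^+ 2 * #|[set W : X | \dim W == k]|%:R.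
  have /(congr1 (fun A => ent A 0%VS 0%VS)) := raise_norm F K k (leq0n n : (0.*2 <= n)%N).
  rewrite entZ ent_mx_of eqxx dimv0 eqxx mulr1 => <-.
  rewrite ent_mul -sum1_card natr_sum mulr_sumr [RHS]big_mkcond; apply: eq_bigr => W _.
  rewrite ent_tr !cE inE; case: eqP => _; rewrite ?mul0r //.
  by rewrite !mul1r mulr1 expr2.
by rewrite /raise_scale subn0 gE sqrtCM ?sqrCK ?qualifE /= ?exprn_ge0 ?ler0n ?raise0_ge0.
Qed.

(** The string from level [0] consists of the constant functions; the
    normalization by norms becomes the one by the sizes of the fibers. *)
Lemma eigmx0 i j : eigmx i j 0 =
  (sqrtC (#|cc_fiber C i| * #|cc_fiber C j|)%N%:R)^-1 *: block_J C K i j.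
Proof.
apply: entP => U V; rewrite [RHS]entZ [in RHS]/ent [in RHS]mxE !enum_rankK !inE.
case: (\dim U =P i :> nat) => [dU|dU]; last first.
  by rewrite mulr0; apply/eqP; apply: contra_notT dU => /(in_block_eigmx (leq0n _) (leq0n _))[].
case: (\dim V =P j :> nat) => [dV|dV]; last first.
  by rewrite mulr0; apply/eqP; apply: contra_notT dV => /(in_block_eigmx (leq0n _) (leq0n _))[].
have r0 k W Y : ent (raise k 0) W Y = (\dim Y == 0)%:R * ent (raise k 0) W Y.
  by rewrite -{1}(raise_harmonic k (leq0n n : (0.*2 <= n)%N)) ent_Mlevel.
rewrite mulr1 entZ ent_mul (bigD1 0%VS) //= big1 ?addr0 => [|W W0]; last first.
  by rewrite r0 dimv_eq0 (negPf W0) !mul0r.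
rewrite ent_tr !subn0 natrM sqrtCM ?qualifE /= ?ler0n //.
have li : (i <= n)%N by rewrite -ltnS.
have lj : (j <= n)%N by rewrite -ltnS.
have := raise_scale_neq0 (leq0n i) li; have := raise_scale_neq0 (leq0n j) lj.
rewrite -(raise0E li dU) -(raise0E lj dV) /subspaces.
rewrite !mulf_eq0 !negb_or => /andP[a b] /andP[c d].
by field; rewrite a b c d.
Qed.

Lemma eigmx_eigenbasis : eigenbasis C eigmx.
Proof.
split.
- exact: eigmx0.
- exact: eigmx_basis.
- by move=> i j l _; apply: eigmx_tr.
- exact: eigmx_mul.
Qed.

(** * Eigenvalues as polynomials *)

(** The coefficient of the [m]-th relation at a pair (U, V) counts the
    neighbours [W] of [U] in relation [l] to [V].  There are none for
    [m > l.+1] by [dim_cap_adjacent], and [exists_closer] provides one for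
    [m = l.+1]. *)
Lemma adjacent_mul i j l : (i <= j)%N -> (eps i j <= l < cc_max C i j)%N ->
  exists2 c : K, c != 0 & exists a : nat -> K,
    adj i i 1 *m adj i j l =
      c *: adj i j l.+1 + \sum_(eps i j <= m < l.+1) a m *: adj i j m.
Proof.
move=> ij /andP[el lm].
have inv : GL_invariant (adj i i 1 *m adj i j l).
  by apply: invariant_mul; apply: invariant_adj.
have blk : in_block i j (adj i i 1 *m adj i j l).
  by apply: in_block_mul; apply: in_block_adj.
have [a [aE aP]] := invariant_decomp inv blk.
have entE U V : ent (adj i i 1 *m adj i j l) U V =
  \sum_W ((U, W) \in cc_rel C i i 1)%:R * ((W, V) \in cc_rel C i j l)%:R.
  by rewrite ent_mul; apply: eq_bigr => W _; rewrite !ent_adj.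
have range m : (eps i j <= m <= cc_max C i j)%N -> in_range C i j m by [].
have aux : (minn i j + eps i j - l)%N = (i + eps i j - l)%N by move: (eps i j) => e; lia.
have maxi : (cc_max C i j <= i + eps i j)%N.
  by rewrite cc_maxE leq_add2r (leq_trans (geq_minl _ _)) // geq_minl.
have one W U : (U, W) \in cc_rel C i i 1 -> \dim W = i /\ (\dim (U :&: W)).+1 = i.
  rewrite C3_relE /= minnn /eps eqxx addn0 => /and3P[_ /eqP-> /eqP e].
  by split=> //; move: (\dim _) e => d; lia.
have far m : (l.+1 < m <= cc_max C i j)%N -> a m = 0.
  (* [m] is further than [l.+1], so the meet of [U] and [V] is at least two
     dimensions smaller than that of [V] with a [W] that would be counted *)
  move=> /andP[lm' mm]; have mr : in_range C i j m by apply: range; lia.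
  have [[U V] UV] := C3_rel_exists mr.
  rewrite (aP _ _ mr UV) entE big1 // => W _.
  case: ((U, W) \in _) / boolP => [/one[dW dUW]|]; last by rewrite mul0r.
  case: ((W, V) \in _) / boolP => [|]; last by rewrite mulr0.
  rewrite C3_rel_dim ?range ?el ?(ltnW lm) //= => /and3P[_ _ /eqP dWV].
  move: UV; rewrite C3_rel_dim //= => /and3P[_ _ /eqP dUV].
  have := dim_cap_adjacent U V W; move: dWV dUV; rewrite dW.
  by move: (eps i j) aux mr maxi => e; rewrite /in_range; lia.
exists (a l.+1).
  have lr : in_range C i j l.+1 by apply: range; lia.
  have [[U V] UV] := C3_rel_exists lr.
  rewrite (aP _ _ lr UV) entE.
  move: (UV); rewrite C3_rel_dim //= => /and3P[/eqP dU /eqP dV /eqP dUV].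
  have [|W [dW dUW dWV]] := @exists_closer _ _ U V.
    by rewrite dUV dU dV ij andbT; lia.
  have w1 : (U, W) \in cc_rel C i i 1.
    rewrite C3_relE /= dW dU !eqxx minnn /eps eqxx addn0 /=; move: dUW; rewrite dU.
    by move=> <-; rewrite subSnn.
  have w2 : (W, V) \in cc_rel C i j l.
    rewrite C3_rel_dim ?range ?el ?(ltnW lm) //= dW dU dV !eqxx /= dWV dUV.
    by apply/eqP; lia.
  rewrite (bigD1 W) //= w1 w2 mulr1 gt_eqF // ltr_pwDl ?ltr01 // sumr_ge0 // => W' _.
  by rewrite mulr_ge0 ?ler0n.
exists a; rewrite aE (big_cat_nat (n := l.+1)) ?leqW //=.
rewrite addrC [X in X + _ = _]big_ltn ?ltnS //; congr (_ + _).
rewrite -[RHS]addr0; congr (_ + _).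
by rewrite big_nat_cond big1 // => m /andP[/far-> _]; rewrite scale0r.
Qed.

Section AnyEigenbasis.
Variable E : 'I_n.+1 -> 'I_n.+1 -> nat -> M.
Hypothesis eigE : eigenbasis C E.

Let P i j l (h : 'I_(rtilde C i j).+1) : K := eigenvalue_P E l h.

Lemma adj_mem i j l : adj i j l \in adj_space C K i j.
Proof. by apply: mem_adj_space; [apply: invariant_adj | apply: in_block_adj]. Qed.

Lemma eig_basis i j : basis_of (adj_space C K i j) (E_tuple C E i j).
Proof. by case: eigE. Qed.

Lemma coord_eig i j A : A \in adj_space C K i j ->
  A = \sum_(h < (rtilde C i j).+1) coord (E_tuple C E i j) h A *: E i j h.
Proof.
move=> /(coord_basis (eig_basis i j)) {1}->.
by apply: eq_bigr => h _; rewrite nth_E_tuple.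
Qed.

Lemma coord_sum_eig i j (c : 'I_(rtilde C i j).+1 -> K) h :
  coord (E_tuple C E i j) h (\sum_(k < (rtilde C i j).+1) c k *: E i j k) = c h.
Proof.
rewrite -[RHS](coord_sum_free c h (basis_free (eig_basis i j))).
by congr coord; apply: eq_bigr => k _; rewrite nth_E_tuple.
Qed.

Lemma adjE i j l : adj i j l = \sum_(h < (rtilde C i j).+1) P l h *: E i j h.
Proof. exact: coord_eig (adj_mem i j l). Qed.

(** Blocks (i, j) and (j, i) have the same eigenvalues, since transposition
    exchanges both their adjacency matrices and their matrices [E]. *)
Lemma eigenvalue_P_tr i j l (e : (rtilde C i j).+1 = (rtilde C j i).+1)
    (h : 'I_(rtilde C i j).+1) : P l h = P l (cast_ord e h).
Proof.
have adj_tr : (adj j i l)^T = adj i j l.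
  apply: entP => U V; rewrite ent_tr !ent_adj !C3_relE /= capvC minnC eps_sym.
  by congr (nat_of_bool _)%:R; case: eqP; case: eqP.
rewrite /P /eigenvalue_P -[in LHS]adj_tr [in LHS]adjE linear_sum /=.
rewrite (reindex (cast_ord e)) /=; last first.
  by exists (cast_ord (esym e)) => k _; rewrite ?cast_ordK ?cast_ordKV.
rewrite -[RHS](coord_sum_eig (fun k => P l (cast_ord e k)) h); congr coord.
apply: eq_bigr => k _; rewrite linearZ /=; congr (_ *: _).
by have [_ _ -> //] := eigE; rewrite -ltnS -e.
Qed.

(** The eigenvalue is the coordinate of [adj i i 1] on [E i i h]; the index [h]
    is in range for (i, i) because [i <= j]. *)
Lemma adjacent_eig i j : (i <= j)%N -> exists tau : nat -> K,
  forall h, (h <= rtilde C i j)%N -> adj i i 1 *m E i j h = tau h *: E i j h.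
Proof.
move=> ij; exists (fun h => P (i := i) (j := i) 1 (inord h)) => h hr.
have hii : (h <= rtilde C i i)%N.
  by move: hr; rewrite !le_rtilde => /and4P[-> _ -> _].
have [_ _ _ mulE] := eigE.
rewrite {1}adjE mulmx_suml (bigD1 (inord h)) //= big1 ?addr0 => [|k kh].
  by rewrite -scalemxAl mulE ?inordK ?ltnS // !eqxx scale1r.
rewrite -scalemxAl mulE -1?ltnS //.
have /negPf kh' : k != h :> nat by apply: contra kh => /eqP <-; rewrite inord_val.
by rewrite kh' andbF scale0r scaler0.
Qed.

Lemma P_recursion i j (tau : nat -> K) l :
  (forall h, (h <= rtilde C i j)%N -> adj i i 1 *m E i j h = tau h *: E i j h) ->
  (i <= j)%N -> (eps i j <= l < cc_max C i j)%N ->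
  exists2 c : K, c != 0 & exists a : nat -> K, forall h : 'I_(rtilde C i j).+1,
    tau h * P l h = c * P l.+1 h + \sum_(eps i j <= m < l.+1) a m * P m h.
Proof.
move=> htau ij lr; have [c c0 [a e]] := adjacent_mul ij lr.
exists c => //; exists a => h.
have : coord (E_tuple C E i j) h (adj i i 1 *m adj i j l) = tau h * P l h.
  rewrite [X in _ *m X]adjE mulmx_sumr.
  rewrite -[RHS](coord_sum_eig (fun h => tau h * P l h) h); congr coord.
  apply: eq_bigr => k _; rewrite -scalemxAr htau 1?mulrC ?scalerA //.
  by rewrite -ltnS.
move=> <-; rewrite e linearD linearZ linear_sum /=; congr (_ + _).
by apply: eq_bigr => m _; rewrite linearZ.
Qed.

Lemma P_not_all_zero i j (h : 'I_(rtilde C i j).+1) :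
  ~ (forall l, in_range C i j l -> P l h = 0).
Proof.
move=> P0.
have sub : (adj_space C K i j <= lker (linfun (coord (E_tuple C E i j) h : M -> K^o)))%VS.
  apply/span_subvP => _ /mapP[l lr ->]; rewrite memv_ker lfunE /=.
  by apply/eqP/P0; move: lr; rewrite mem_index_iota.
have : E i j h \in adj_space C K i j.
  rewrite -(span_basis (eig_basis i j)) -nth_E_tuple; apply/memv_span/mem_nth.
  by rewrite size_tuple.
move=> /(subvP sub); rewrite memv_ker lfunE /= -nth_E_tuple.
by rewrite coord_free ?(basis_free (eig_basis i j)) // eqxx oner_eq0.
Qed.

(** The recursion makes [P l h] equal to [(w (l - eps i j)).[tau h] * P (eps i j) h].
    Nonvanishing of the last factor follows since the [P l h] are not all zero.
    The polynomial [w 1] is affine with invertible slope, and [u] is its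
    inverse, so that composition with [u] expresses everything in the value
    of [w 1]. *)
Lemma P_polynomial_le i j : (i <= j)%N -> P_polynomial_ordering C E id i j.
Proof.
move=> ij; have [tau htau] := adjacent_eig ij.
have maxE : cc_max C i j = (eps i j + rtilde C i j)%N.
  by rewrite rtildeE cc_maxE addnC.
have [k kr|w hw] := @polynomials_of_recursion K 'I_(rtilde C i j).+1 (fun h => tau h)
   (fun k h => P (eps i j + k) h) (rtilde C i j).
  have [|c c0 [a ha]] := @P_recursion i j tau (eps i j + k) htau ij.
    by rewrite leq_addr maxE ltn_add2l.
  exists c => //; exists (fun m => a (eps i j + m)%N) => h; rewrite ha addnS.
  congr (_ + _); rewrite -addnS -[X in \sum_(X <= _ < _) _]add0n big_addn addKn big_mkord.
  by apply: eq_bigr => m _; rewrite addnC.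
have P0 (h : 'I_(rtilde C i j).+1) : P (eps i j) h != 0.
  apply/eqP => P0; case: (@P_not_all_zero i j h) => l /andP[el lm].
  have [|_] := hw (l - eps i j)%N; first by rewrite leq_subLR -maxE.
  by rewrite subnKC // => ->; rewrite addn0 P0 mulr0.
split=> //.
have normE l (h : 'I_(rtilde C i j).+1) : in_range C i j l ->
    normalized_P E id l h = (w (l - eps i j)%N).[tau h].
  move=> /andP[el lm]; have [|_] := hw (l - eps i j)%N; first by rewrite leq_subLR -maxE.
  by rewrite /normalized_P -/(P l h) subnKC // => ->; rewrite addn0 mulfK.
have [r0|r0] := posnP (rtilde C i j).
  (* a single relation: the second eigenvalue does not exist *)
  exists (fun=> 1) => l lr; have -> : l = eps i j.
    by move: lr; rewrite /in_range maxE r0 addn0 => /andP[*]; apply/anti_leq/andP.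
  rewrite subnn size_poly1; split=> // h.
  by rewrite /normalized_P divff ?P0 // hornerE.
have [s1 _] := hw 1%N r0.
have w10 : (w 1%N)`_1 != 0.
  have : lead_coef (w 1%N) != 0 by rewrite lead_coef_eq0 -size_poly_eq0 s1.
  by rewrite lead_coefE s1.
have w1E x : (w 1%N).[x] = (w 1%N)`_1 * x + (w 1%N)`_0.
  by rewrite horner_coef s1 big_ord_recl big_ord1 /= expr0 mulr1 expr1 addrC.
pose u := ((w 1%N)`_1)^-1 *: ('X - ((w 1%N)`_0)%:P).
exists (fun l => w (l - eps i j)%N \Po u) => l lr.
have [|sw _] := hw (l - eps i j)%N; first by rewrite leq_subLR -maxE; case/andP: lr.
split=> [|h].
  by rewrite size_comp_poly2 // size_scale ?invr_eq0 // size_XsubC.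
have r1 : in_range C i j (1 + eps i j)%N.
  by rewrite /in_range leq_addl maxE addnC leq_add2l.
rewrite horner_comp normE // (normE _ _ r1) addnK w1E; congr (_.[_]).
by rewrite hornerZ hornerXsubC addrK mulKf.
Qed.

Lemma P_polynomial_ordering_tr i j :
  P_polynomial_ordering C E id i j -> P_polynomial_ordering C E id j i.
Proof.
have e : (rtilde C j i).+1 = (rtilde C i j).+1 by rewrite rtilde_sym.
have maxC : cc_max C j i = cc_max C i j.
  by rewrite !cc_maxE minnC [maxn j i]maxnC eps_sym [minn j i]minnC minnC.
move=> [nz [v hv]]; split=> [h|].
  have := nz (cast_ord e h); rewrite (eps_sym j i) -[eigenvalue_P _ _ h]/(P _ h).
  by rewrite (eigenvalue_P_tr _ e).
exists v => l; rewrite /in_range maxC (eps_sym j i) => /hv[sv ev]; split=> // h.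
have := ev (cast_ord e h); rewrite /normalized_P (eps_sym j i).
by rewrite -!/(P _ _) !(eigenvalue_P_tr _ e).
Qed.

Lemma P_polynomial_any : P_polynomial_wrt C E.
Proof.
move=> i j; exists id; split; first by split; rewrite ?map_id.
by case: (leqP i j) => ij; last apply: P_polynomial_ordering_tr;
  apply: P_polynomial_le => //; apply: ltnW.
Qed.

End AnyEigenbasis.

End Eigenbases.

Theorem theorem5p8 (R : realType) (F : finFieldType) (n : nat) (hn : (0 < n)%N) :
  numbered_coherent_configuration (C3 F n) /\ P_polynomial (C3 F n) (complex R).
Proof.
split; first exact: C3_numbered.
split; first by exists (@eigmx F n (complex R)); apply: eigmx_eigenbasis.
by move=> E; apply: P_polynomial_any.
Qed.
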